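(* Fix integers $0\le\nu\le p$ and a point $x\in(0,1)$. In the model, with the local polynomial estimator $\hat m_\nu(x)$ of order $p$ and the kernel-moment quantities $\mathbf S,\tilde{\mathbf S},\mathbf S^\ast,\mathbf A,\mathbf c,\tilde{\mathbf c}$ described in the context, assume: (A1) The kernel $K$ is a Lipschitz-continuous, symmetric density function with support $[-1,1]$. (A2) The bandwidth $h=h(\nu,n,N)>0$ satisfies $h\to0$, $Nh^2\to\infty$ and $nh^{2\nu}\to\infty$ as $n,N\to\infty$. (A3) The regression function $m$ has $p+2$ continuous derivatives on $[0,1]$. (A4) The sampling density $f$ has one continuous derivative on $[0,1]$. (A5) The covariance function $\rho$ is continuous on $[0,1]^2$ and has continuous first-order partial derivatives off the main diagonal; these derivatives have left and right limits on the main diagonal determined by $\rho^{(0,1)}(x,x^-)=\lim_{y\nearrow x}\rho^{(0,1)}(x,y)$ and $\rho^{(0,1)}(x,x^+)=\lim_{y\searrow x}\rho^{(0,1)}(x,y)$. Then, as $n,N\to\infty$, $$\mathrm{Bias}(\hat m_\nu(x))=\frac{\nu!\,m^{(p+1)}(x)}{(p+1)!}\left(\mathbf e_\nu'\mathbf S^{-1}\mathbf c\right)h^{p+1-\nu}+\nu!\left\{\frac{m^{(p+2)}(x)}{(p+2)!}\,\mathbf e_\nu'\mathbf S^{-1}\tilde{\mathbf c}+\frac{m^{(p+1)}(x)}{(p+1)!}\frac{f'(x)}{f(x)}\left(\mathbf e_\nu'\mathbf S^{-1}\tilde{\mathbf c}-\mathbf e_\nu'\mathbf S^{-1}\tilde{\mathbf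 S}\mathbf S^{-1}\mathbf c\right)\right\}h^{p+2-\nu}+o(h^{p+2-\nu})$$ and $$\mathrm{Var}(\hat m_\nu(x))=\frac{(\nu!)^2\rho(x,x)}{nh^{2\nu}}\,\mathbf e_\nu'\mathbf S^{-1}\mathbf S^\ast\mathbf S^{-1}\mathbf e_\nu-\frac{(\nu!)^2}{nh^{2\nu-1}}\left(\rho^{(0,1)}(x,x^-)-\rho^{(0,1)}(x,x^+)\right)\mathbf e_\nu'\mathbf S^{-1}\mathbf A\mathbf S^{-1}\mathbf e_\nu+o\!\left(\frac1{nh^{2\nu-1}}\right).$$
   Context: Model. One observes $Y_i(x_j)=m(x_j)+\varepsilon_i(x_j)$, $i=1,\dots,n$, $j=1,\dots,N$, where $m:[0,1]\to\mathbb R$ is a (non-random) regression function and $\varepsilon_1,\dots,\varepsilon_n$ are i.i.d. stochastic processes on $[0,1]$ with mean zero and covariance function $\rho(y,z)=\mathbb E[\varepsilon_i(y)\varepsilon_i(z)]$. The design points $x_j=x_{j,N}$ are determined by a continuous positive probability density $f$ on $[0,1]$ through $\int_0^{x_j}f(t)\,dt=\frac{j-1}{N-1}$, $j=1,\dots,N$. Estimator. Let $\bar Y_{\cdot j}=\frac1n\sum_{i=1}^nY_i(x_j)$. Given a bandwidth $h>0$ and a kernel $K$, let $\hat{\boldsymbol\beta}(x)=(\hat\beta_0(x),\dots,\hat\beta_p(x))$ be the solution of $\min_{\beta_0,\dots,\beta_p}\sum_{j=1}^N\left(\bar Y_{\cdot j}-\sum_{k=0}^p\beta_k(x_j-x)^k\right)^2\frac1hK\left(\frac{x_j-x}{h}\right)$.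 The local polynomial estimator of order $p$ of $m^{(\nu)}(x)$ is $\hat m_\nu(x)=\nu!\,\hat\beta_\nu(x)$. $\mathrm{Bias}(\hat m_\nu(x))=\mathbb E\,\hat m_\nu(x)-m^{(\nu)}(x)$. Notation. $\rho^{(a,b)}$ denotes the partial derivative of order $a$ in the first and $b$ in the second variable. $\mu_k=\int_{-1}^1u^kK(u)\,du$; $\mathbf c=(\mu_{p+1},\dots,\mu_{2p+1})'$, $\tilde{\mathbf c}=(\mu_{p+2},\dots,\mu_{2p+2})'$. With indices $k,l=0,\dots,p$, define the $(p+1)\times(p+1)$ matrices $\mathbf S=(\mu_{k+l})$, $\tilde{\mathbf S}=(\mu_{k+l+1})$, $\mathbf S^\ast=(\mu_k\mu_l)$, $\mathbf A=\left(\frac12\iint_{[-1,1]^2}|u-v|u^kv^lK(u)K(v)\,du\,dv\right)$. $(\mathbf e_k)_{k=0,\dots,p}$ is the canonical basis of $\mathbb R^{p+1}$ ($\mathbf e_k$ has a 1 in position $k+1$). A prime on a vector or matrix denotes transpose.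
   Formalization: In (A5) the left and right limits of the first-order partial derivatives of ρ on the main diagonal are taken as two-variable limits from each of the two triangles; limits along vertical lines alone would not suffice for the variance expansion. *)

(* Defs.v *)
From HB Require Import structures.
From mathcomp Require Export all_boot all_order all_algebra.
From mathcomp Require Export all_classical all_reals all_analysis.
Export Order.TTheory GRing.Theory Num.Theory.
Export numFieldNormedType.Exports.

Set Implicit Arguments.
Unset Strict Implicit.
Unset Printing Implicit Defensive.

Local Open Scope classical_set_scope.
Local Open Scope ring_scope.

(* At an interior point of A this is the usual derivative; at an endpoint of a
   closed interval it is the one-sided derivative. *)
Definition is_derive_within (R : realType) (A : set R) (g : R -> R) (y l : R) :
  Prop := (g z - g y) / (z - y) @[z --> within A y^'] --> l.

Definition Ck_on (R : realType) (A : set R) (k : nat) (g : R -> R) : Prop :=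
  exists D : nat -> R -> R,
    [/\ D 0%N = g,
        forall j : nat, (j <= k)%N -> {within A, continuous (D j)} &
        forall (j : nat) (y : R), (j < k)%N -> A y ->
          is_derive_within A (D j) y (D j.+1 y)].

Definition process_sigma_algebra (R : realType) d (T : measurableType d)
    (D : set R) (X : R -> T -> R) : set (set T) :=
  <<s [set E | exists t : R, exists2 B : set R,
                 D t /\ measurable B & E = X t @^-1` B] >>.

Definition mutually_independent (R : realType) d (T : measurableType d)
    (P : probability T R) (D : set R) (X : nat -> R -> T -> R) : Prop :=
  forall (J : seq nat) (E : nat -> set T), uniq J ->
    (forall i : nat, i \in J -> process_sigma_algebra D (X i) (E i)) ->
    P (\bigcap_(i in [set` J]) E i) = (\prod_(i <- J) P (E i))%E.

(* Equality of the finite-dimensional distributions, which are determined by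
   their values on measurable rectangles. *)
Definition identically_distributed (R : realType) d (T : measurableType d)
    (P : probability T R) (D : set R) (X : nat -> R -> T -> R) : Prop :=
  forall (i i' k : nat) (t : 'I_k -> R) (B : 'I_k -> set R),
    (forall l, D (t l)) -> (forall l, measurable (B l)) ->
    P [set w | forall l, B l (X i (t l) w)] =
    P [set w | forall l, B l (X i' (t l) w)].

(* The second-moment identity takes place in \bar R: as rho is real-valued, it
   entails that every eps i y, y in [0, 1], is square integrable. *)
Definition iid_centered_errors (R : realType) d (T : measurableType d)
    (P : probability T R) (eps : nat -> R -> {RV P >-> R})
    (rho : R -> R -> R) : Prop :=
  [/\ mutually_independent P `[0, 1] (fun i t => eps i t : T -> R),
      identically_distributed P `[0, 1] (fun i t => eps i t : T -> R),
      forall (i : nat) (y : R), y \in `[0, 1] -> ('E_P[eps i y] = 0)%E &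
      forall (i : nat) (y z : R), y \in `[0, 1] -> z \in `[0, 1] ->
        ('E_P[fun w => (eps i y w * eps i z w)%R] = (rho y z)%:E)%E].

Definition positive_density01 (R : realType) (f : R -> R) : Prop :=
  [/\ {within `[0, 1], continuous f},
      forall t, t \in `[0, 1] -> 0 < f t &
      (\int[@lebesgue_measure R]_(t in `[0%R, 1%R]) (f t)%:E = 1)%E].

(* Design points are numbered from 0, so that xd N j is the point x_{j+1,N}. *)
Definition design_points (R : realType) (f : R -> R)
    (xd : forall N : nat, 'I_N -> R) : Prop :=
  forall (N : nat) (j : 'I_N), (1 < N)%N ->
    xd N j \in `[0, 1] /\
    \int[@lebesgue_measure R]_(t in `[0, xd N j]) f t = j%:R / N.-1%:R.

Definition mean_obs (R : realType) (T : Type) (m : R -> R)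
    (eps : nat -> R -> T -> R) (n N : nat) (xd : 'I_N -> R) (w : T) (j : 'I_N) : R :=
  n%:R^-1 * \sum_(i < n) (m (xd j) + eps i (xd j) w).

Definition wls (R : realType) (K : R -> R) (h x : R) (N : nat)
    (xd y : 'I_N -> R) (p : nat) (b : 'cV[R]_p.+1) : R :=
  \sum_(j < N) (y j - \sum_(k < p.+1) b k 0 * (xd j - x) ^+ k) ^+ 2 *
    (h^-1 * K ((xd j - x) / h)).

(* A minimizer always exists; when it is not unique (a degenerate design in the
   window, which does not occur asymptotically) an arbitrary one is chosen. *)
Definition lp_coef (R : realType) (K : R -> R) (h x : R) (N : nat)
    (xd y : 'I_N -> R) (p : nat) : 'cV[R]_p.+1 :=
  xget 0 [set b | forall b' : 'cV[R]_p.+1, wls K h x xd y b <= wls K h x xd y b'].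

(* Local polynomial estimator of order p of the derivative of order nu <= p. *)
Definition lp_estimator (R : realType) (K : R -> R) (h x : R) (N : nat)
    (xd y : 'I_N -> R) (p : nat) (nu : 'I_p.+1) : R :=
  nu`!%:R * lp_coef K h x xd y p nu 0.

Definition bias (R : realType) d (T : measurableType d) (P : probability T R)
    (estimator : T -> R) (target : R) : R := fine 'E_P[estimator] - target.

Definition var (R : realType) d (T : measurableType d) (P : probability T R)
    (estimator : T -> R) : R := fine 'V_P[estimator].

Definition kernel_moment (R : realType) (K : R -> R) (k : nat) : R :=
  \int[@lebesgue_measure R]_(u in `[-1, 1]) (u ^+ k * K u).

Definition vec_c (R : realType) (K : R -> R) (p : nat) : 'cV[R]_p.+1 :=
  \col_k kernel_moment K (p.+1 + k).

Definition vec_c_tilde (R : realType) (K : R -> R) (p : nat) : 'cV[R]_p.+1 :=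
  \col_k kernel_moment K (p.+2 + k).

Definition mat_S (R : realType) (K : R -> R) (p : nat) : 'M[R]_p.+1 :=
  \matrix_(k, l) kernel_moment K (k + l).

Definition mat_S_tilde (R : realType) (K : R -> R) (p : nat) : 'M[R]_p.+1 :=
  \matrix_(k, l) kernel_moment K (k + l).+1.

Definition mat_S_star (R : realType) (K : R -> R) (p : nat) : 'M[R]_p.+1 :=
  \matrix_(k, l) (kernel_moment K k * kernel_moment K l).

Definition mat_A (R : realType) (K : R -> R) (p : nat) : 'M[R]_p.+1 :=
  \matrix_(k, l) (2^-1 *
    \int[(@lebesgue_measure R \x @lebesgue_measure R)%E]_(w in `[-1, 1]%classic `*` `[-1, 1]%classic)
      (`|w.1 - w.2| * w.1 ^+ k * w.2 ^+ l * K w.1 * K w.2)).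

Definition e_ (R : realType) (p : nat) (nu : 'I_p.+1) : 'cV[R]_p.+1 :=
  delta_mx nu 0.

Definition kernel_assumption (R : realType) (K : R -> R) : Prop :=
  [/\ lipschitz K,
      forall u, K (- u) = K u,
      forall u, 0 <= K u,
      (\int[@lebesgue_measure R]_u (K u)%:E = 1)%E &
      closure [set u | K u != 0] = `[-1, 1]%classic].

(* n, N --> oo with no constraint on their relative growth. *)
Definition sizes_oo : set_system (nat * nat) := filter_prod \oo \oo.

Definition bandwidth_assumption (R : realType) (nu : nat)
    (h : nat -> nat -> R) : Prop :=
  [/\ forall n N, 0 < h n N,
      h z.1 z.2 @[z --> sizes_oo] --> (0 : R),
      z.2%:R * h z.1 z.2 ^+ 2 @[z --> sizes_oo] --> +oo &
      z.1%:R * h z.1 z.2 ^+ (2 * nu) @[z --> sizes_oo] --> +oo].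

Definition square01 (R : realType) : set (R * R) := `[0, 1]%classic `*` `[0, 1]%classic.

(* r10 and r01 are the partial derivatives of rho. They have a limit at each
   point of the main diagonal along each of the two triangles separated by it,
   that is, they extend continuously to both closed triangles. The existence of
   limits along vertical lines only would not control rho near (x, x). *)
Definition covariance_assumption (R : realType) (rho : R -> R -> R) : Prop :=
  let off := @square01 R `&` [set w | w.1 != w.2] in
  let below := @square01 R `&` [set w | w.2 < w.1] in
  let above := @square01 R `&` [set w | w.1 < w.2] in
  {within @square01 R, continuous (fun w : R * R => rho w.1 w.2)} /\
  exists r10 r01 : R * R -> R,
    [/\ forall w, off w ->
          is_derive_within `[0, 1] (rho ^~ w.2) w.1 (r10 w) /\
          is_derive_within `[0, 1] (rho w.1) w.2 (r01 w),
        {within off, continuous r10},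
        {within off, continuous r01} &
        forall t : R, t \in `[0, 1] ->
          [/\ cvg (r10 @ within below (nbhs (t, t))),
              cvg (r10 @ within above (nbhs (t, t))),
              cvg (r01 @ within below (nbhs (t, t))) &
              cvg (r01 @ within above (nbhs (t, t)))]].

Definition rho01_left (R : realType) (rho : R -> R -> R) (x : R) : R :=
  lim (derive1 (rho x) y @[y --> x^'-]).

Definition rho01_right (R : realType) (rho : R -> R -> R) (x : R) : R :=
  lim (derive1 (rho x) y @[y --> x^'+]).

(* Main.v *)
(** Put [u_j = (x_j - x) / h] and [w_j = K(u_j) / ((N - 1) h)].  Weighted least
    squares is invariant under rescaling of the regressors and of the weights, so
    the estimator is [nu! h^-nu e_nu' M^-1 v] with [M = (sum_j w_j u_j^(k+l))] and
    [v = (sum_j w_j u_j^k Ybar_j)].  The mean value theorem for the distribution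
    function of [f] gives [1 / ((N - 1) h) = f(xi_j) (u_(j+1) - u_j)], hence
    weighted sums are Riemann sums of mesh [O(1 / (N h)) = o(h)], and
    [sum_j w_j u_j^k = f(x) mu_k + h f'(x) mu_(k+1) + o(h)].

    Bias: [M^-1] reproduces the Taylor polynomial of degree [p] of [m] exactly; the
    terms of degree [p + 1] and [p + 2] produce the two terms of the expansion.

    Variance: independence reduces it to [1/n] times a quadratic form in
    [rho(x_i, x_j)], and [rho] is expanded at [(x, x)] on each side of the diagonal.
    The constant [rho(x, x)] contributes [rho(x, x) s s'] with [s = M e_0], so that
    [M^-1 s = e_0] without any error; the part linear in [u_i + u_j] cancels in the
    limit because [(e_nu' S^-1 S~ e_0) (e_nu' e_0) = 0]; the jump of the derivative
    across the diagonal contributes the kernel [|u_i - u_j|], that is, [A]. *)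

Require Import Defs.
From mathcomp Require Import ring lra zify measurable_realfun.

Set Implicit Arguments.
Unset Strict Implicit.
Unset Printing Implicit Defensive.

Local Open Scope classical_set_scope.
Local Open Scope ring_scope.

(** * Moments of independent random variables *)

(** The bandwidth depends on both sizes and nothing ties [n] to [N], so the estimates on the design
    are not limits: they are bounds valid for all [M = N - 1] and [h] with [h] and [1 / (M h^2)]
    below a threshold [tau], which the last part turns into statements along [sizes_oo]. The
    second-order bias needs single moments with error [o(h)], whereas the sum carrying [|u_i - u_j|]
    enters with a factor [h] and needs only [o(1)]. As [K] is merely Lipschitz, Riemann errors come
    from the mean value theorem for a primitive, and design points in the window are never counted:
    errors are summed against [|g(u_j)| (u_(j+1) - u_j)], itself a bounded Riemann sum. The
    estimator is an arbitrary minimizer, hence known to be linear in the data only where the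
    minimizer is unique. This holds eventually, because the Gram matrix tends to [f(x) S] and [S] is
    positive definite: its quadratic form is the integral of [q^2 K] for a polynomial [q] of degree
    at most [p]. *)

Lemma product_integrableM d1 d2 (T1 : measurableType d1) (T2 : measurableType d2)
    (R : realType) (m1 : {sigma_finite_measure set T1 -> \bar R})
    (m2 : {sigma_finite_measure set T2 -> \bar R}) (f : T1 -> R) (g : T2 -> R) :
  m1.-integrable setT (EFin \o f) -> m2.-integrable setT (EFin \o g) ->
  (m1 \x m2)%E.-integrable setT (fun z => (f z.1 * g z.2)%:E).
Proof.
move=> /[dup] fi /integrableP[mf foo] /[dup] gi /integrableP[mg goo].
have mfg : measurable_fun [set: T1 * T2] (fun z => (f z.1 * g z.2)%:E).
  apply/measurable_EFinP; apply: measurable_funM.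
    by apply: measurableT_comp; [exact/measurable_EFinP|].
  by apply: measurableT_comp; [exact/measurable_EFinP|].
apply/(integrable12ltyP m1 m2 mfg).
under eq_integral => t _.
  under eq_integral => s _ do rewrite /= normrM EFinM.
  rewrite ge0_integralZl ?integral_ge0//; last first.
    by apply/measurable_EFinP; apply: measurableT_comp => //; exact/measurable_EFinP.
  over.
rewrite ge0_integralZr ?integral_ge0//; last first.
  by apply/measurable_EFinP; apply: measurableT_comp => //; exact/measurable_EFinP.
by rewrite lte_mul_pinfty ?ge0_fin_numE ?integral_ge0.
Qed.

Section probability_facts.
Context d (T : measurableType d) (R : realType) (P : probability T R).

Lemma expectation_lincomb (I : finType) (a r : I -> R) (X : I -> T -> R) :
  (forall i, X i \in Lfun P 1) -> (forall i, 'E_P[X i] = (r i)%:E)%E ->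
  (fun w => \sum_i a i * X i w) \in Lfun P 1 /\
  ('E_P[fun w => (\sum_i a i * X i w)%R] = (\sum_i a i * r i)%:E)%E.
Proof.
move=> X1 Er.
have aX1 i : (a i \o* X i) \in Lfun P 1 by rewrite Lfun_scale.
have -> : (fun w => \sum_i a i * X i w) = \sum_i (a i \o* X i).
  apply/funext => w; rewrite fct_sumE.
  by apply: eq_bigr => i _ /=; rewrite mulrC.
elim/big_rec2 : _ => [|i s Y _ [Y1 EY]].
  by rewrite -[0]/(cst 0) expectation_cst Lfun_cst.
split; first by rewrite rpredD.
by rewrite expectationD//= expectationZl// Er EY EFinD EFinM.
Qed.

(** The law of the pair and the product of the marginal laws agree on rectangles, hence coincide by
    uniqueness of the product measure; Fubini then splits the integral of [z.1 * z.2]. *)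
Lemma expectationM_indep (X Y : {RV P >-> R}) :
  (X : T -> R) \in Lfun P 1 -> (Y : T -> R) \in Lfun P 1 ->
  (forall A B, measurable A -> measurable B ->
    P (X @^-1` A `&` Y @^-1` B) = P (X @^-1` A) * P (Y @^-1` B))%E ->
  ('E_P[fun w => (X w * Y w)%R] = 'E_P[X] * 'E_P[Y])%E.
Proof.
move=> /Lfun1_integrable iX /Lfun1_integrable iY indep.
pose Z w := (X w, Y w).
have mZ : measurable_fun setT Z by apply/measurable_fun_pair.
pose Zm := mfun_Sub (mem_set mZ).
pose f (z : R * R) := (z.1 * z.2)%:E.
have mf : measurable_fun [set: R * R] f.
  by apply/measurable_EFinP; exact: measurable_funM.
have distZ A : measurable A ->
    (distribution P X \x distribution P Y)%E A = distribution P Zm A.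
  by apply: product_measure_unique => B C mB mC; exact: indep.
have iXd : (distribution P X).-integrable setT (EFin \o id).
  apply/integrableP; split; first exact/measurable_EFinP.
  rewrite ge0_integral_distribution//; last first.
    by apply/measurableT_comp => //; exact/measurable_EFinP.
  by have /integrableP[] := iX.
have iYd : (distribution P Y).-integrable setT (EFin \o id).
  apply/integrableP; split; first exact/measurable_EFinP.
  rewrite ge0_integral_distribution//; last first.
    by apply/measurableT_comp => //; exact/measurable_EFinP.
  by have /integrableP[] := iY.
have ifd : (distribution P X \x distribution P Y)%E.-integrable setT f.
  exact: product_integrableM iXd iYd.
have ifZ : P.-integrable setT (f \o Z).
  apply/integrableP; split; first exact: measurableT_comp.
  have mabsf : measurable_fun [set: R * R] (fun z => `|f z|%E) by exact: measurableT_comp.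
  rewrite -(@ge0_integral_distribution _ _ _ _ _ _ Zm (fun z => `|f z|%E))//.
  rewrite (@eq_measure_integral _ _ _ _ (distribution P X \x distribution P Y)%E).
    by have /integrableP[] := ifd.
  by move=> A mA _; exact/esym/distZ.
rewrite unlock -[LHS](@integral_distribution _ _ _ _ _ _ Zm f)//.
rewrite (@eq_measure_integral _ _ _ _ (distribution P X \x distribution P Y)%E);
  last by move=> A mA _; exact/esym/distZ.
rewrite -integral12_prod_meas1//.
rewrite -[in RHS](@integral_distribution _ _ _ _ _ _ X (EFin \o id))//; last exact/measurable_EFinP.
rewrite -[in RHS](@integral_distribution _ _ _ _ _ _ Y (EFin \o id))//; last exact/measurable_EFinP.
rewrite /fubini_F.
under eq_integral => t _.
  rewrite /f/=; under eq_integral => s _ do rewrite EFinM.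
  rewrite integralZl//.
  rewrite -[X in (_ * X)%E](@fineK _) ?integrable_fin_num//.
  over.
by rewrite integralZr// fineK ?integrable_fin_num.
Qed.

(** The second-moment identity of the model is in the extended reals; its finiteness supplies the
    integrability that the rules for expectation and variance require. *)
Lemma sqr_integrable_Lfun2 (X : {RV P >-> R}) (r : R) :
  ('E_P[fun w => (X w * X w)%R] = r%:E)%E -> (X : T -> R) \in Lfun P 2%:E.
Proof.
rewrite unlock => EX.
apply/andP; split; rewrite inE//=.
rewrite /finite_norm unlock poweR_lty//.
rewrite (eq_integral (fun w => (X w * X w)%:E)) ?EX ?ltry// => w _.
by rewrite /= powR_mulrn// -normrX ger0_norm ?sqr_ge0// expr2.
Qed.

(** The centred statistic is a linear combination indexed by pairs [(i, j)], and its square by pairs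
    of pairs. Independence kills the terms with two different replicates; the remaining [n] equal
    blocks, each with the factor [n^-2], leave [n^-1]. *)
Lemma variance_lincomb_indep (n N : nat) (a : 'I_N -> R) (c : R)
    (X : nat -> 'I_N -> {RV P >-> R}) (r : 'I_N -> 'I_N -> R) :
  (0 < n)%N ->
  (forall i j, 'E_P[X i j] = 0)%E ->
  (forall i j l, 'E_P[fun w => (X i j w * X i l w)%R] = (r j l)%:E)%E ->
  (forall i i' j l A B, i != i' -> measurable A -> measurable B ->
    P (X i j @^-1` A `&` X i' l @^-1` B) =
    P (X i j @^-1` A) * P (X i' l @^-1` B))%E ->
  let Y w := c + \sum_j a j * (n%:R^-1 * \sum_(i < n) X i j w) in
  ('E_P[Y] = c%:E)%E /\
  ('V_P[Y] = (n%:R^-1 * \sum_j \sum_l a j * a l * r j l)%:E)%E.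
Proof.
move=> n0 EX EXX indep Y.
have n0R : n%:R != 0 :> R by rewrite pnatr_eq0 -lt0n.
have X2 i j : (X i j : T -> R) \in Lfun P 2%:E.
  exact: sqr_integrable_Lfun2 (EXX i j j).
have X1 i j : (X i j : T -> R) \in Lfun P 1.
  by apply: Lfun_subset12 (X2 i j); exact: fin_num_measure.
pose U (k : 'I_n * 'I_N) : T -> R := X k.1 k.2.
pose b (k : 'I_n * 'I_N) : R := n%:R^-1 * a k.2.
pose Q w := \sum_k b k * U k w.
have YE w : Y w = c + Q w.
  rewrite /Y /Q; congr (_ + _).
  rewrite -(pair_bigA _ (fun i j => b (i, j) * U (i, j) w))/=.
  rewrite exchange_big/=; apply: eq_bigr => j _.
  rewrite !mulr_sumr; apply: eq_bigr => i _.
  by rewrite /b /U/= mulrCA mulrA.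
have [Q1 EQ] := expectation_lincomb b (fun k => X1 k.1 k.2) (fun k => EX k.1 k.2).
have EY : ('E_P[Y] = c%:E)%E.
  have -> : Y = (cst c \+ Q)%R by apply/funext => w; rewrite YE.
  rewrite expectationD ?Lfun_cst// expectation_cst EQ.
  by rewrite big1 ?adde0// => i _; rewrite mulr0.
split => //.
rewrite /variance unlock EY/=.
pose UU (k : ('I_n * 'I_N) * ('I_n * 'I_N)) : T -> R := U k.1 \* U k.2.
pose bb (k : ('I_n * 'I_N) * ('I_n * 'I_N)) : R := b k.1 * b k.2.
pose rr (k : ('I_n * 'I_N) * ('I_n * 'I_N)) : R :=
  if k.1.1 == k.2.1 then r k.1.2 k.2.2 else 0.
have UU1 k : UU k \in Lfun P 1 by apply: Lfun2_mul_Lfun1; exact: X2.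
have EUU k : ('E_P[UU k] = (rr k)%:E)%E.
  rewrite /rr; have [e|ne] := eqVneq.
    by rewrite /UU /U e; exact: EXX.
  rewrite [LHS]expectationM_indep ?EX ?mul0e; first by [].
  - exact: X1.
  - exact: X1.
  - by move=> A B mA mB; apply: indep.
have [_] := expectation_lincomb bb UU1 EUU.
have -> : (fun w => \sum_i bb i * UU i w) =
    (Y \- cst c) * (Y \- cst c).
  apply/funext => w; rewrite mulrfctE /= YE addrC addKr.
  rewrite /Q big_distrlr/= pair_bigA/=.
  by apply: eq_bigr => k _; rewrite /bb /UU/=; ring.
move=> ->; congr (_%:E).
rewrite -(pair_bigA _ (fun k l => bb (k, l) * rr (k, l)))/=.
transitivity (\sum_(i < n) \sum_j \sum_l n%:R^-1 ^+ 2 * (a j * a l * r j l)).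
  rewrite -(pair_bigA _ (fun i j => \sum_l bb ((i, j), l) * rr ((i, j), l)))/=.
  apply: eq_bigr => i _; apply: eq_bigr => j _.
  rewrite -(pair_bigA _ (fun i' l => bb ((i, j), (i', l)) * rr ((i, j), (i', l))))/=.
  rewrite (bigD1 i)//= [X in _ + X]big1 ?addr0.
    by apply: eq_bigr => l _; rewrite /bb /rr /b/= eqxx; ring.
  move=> i' ii'; apply: big1 => l _.
  by rewrite /rr/= eq_sym (negbTE ii') mulr0.
rewrite sumr_const card_ord -[LHS]mulr_natl.
rewrite [X in _ * X](_ : _ = n%:R^-1 ^+ 2 * \sum_j \sum_l a j * a l * r j l).
  by rewrite mulrA expr2 mulrA divff// mul1r.
by rewrite mulr_sumr; apply: eq_bigr => j _; rewrite mulr_sumr.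
Qed.

Lemma mutually_independent_pair (D : set R) (X : nat -> R -> T -> R)
    (i i' : nat) (s t : R) (A B : set R) :
  mutually_independent P D X -> i != i' -> D s -> D t ->
  measurable A -> measurable B ->
  P (X i s @^-1` A `&` X i' t @^-1` B) =
    (P (X i s @^-1` A) * P (X i' t @^-1` B))%E.
Proof.
move=> indep ii' Ds Dt mA mB.
pose E k := if k == i then X i s @^-1` A else X i' t @^-1` B.
have := indep [:: i; i'] E; rewrite /= inE ii' => /(_ isT).
rewrite !big_cons big_nil mule1 /E eqxx eq_sym (negbTE ii').
rewrite (_ : \bigcap_(_ in _) _ = X i s @^-1` A `&` X i' t @^-1` B).
  apply=> k; rewrite !inE => /orP[/eqP->|/eqP->].
    by rewrite eqxx; apply: sub_sigma_algebra; exists s, A.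
  rewrite eq_sym (negbTE ii'); apply: sub_sigma_algebra.
  by exists t, B.
apply/seteqP; split => [w h|w [h1 h2] k]/=.
  split; first by have := h i; rewrite /= inE eqxx; apply.
  by have := h i'; rewrite /= !inE eqxx orbT eq_sym (negbTE ii'); apply.
by rewrite !inE => /orP[/eqP->|/eqP->]; rewrite ?eqxx// eq_sym (negbTE ii').
Qed.

End probability_facts.

(** * Riemann sums of Lipschitz functions supported in [[-1, 1]] *)

Section riemann_sums.
Context (R : realType).
Local Notation mu := (@lebesgue_measure R).
Implicit Types (g : R -> R) (L del : R).

(** The Lipschitz bound on the whole line, not only on [-1, 1], forces [g] to vanish at both
    endpoints and lets the integral over [-1, 1] be read as an increment of a primitive taken from
    -oo. *)
Definition lipschitz_bump L g :=
  (forall s t, `|g s - g t| <= L * `|s - t|) /\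
  (forall t, t \notin `[-1, 1] -> g t = 0).

Lemma lipschitz_bump_continuous L g : lipschitz_bump L g -> continuous g.
Proof.
move=> [gL _] s; apply/cvgrPdist_le => e e0.
have L1 : 0 < `|L| + 1 by rewrite ltr_pwDr.
near=> t; rewrite (le_trans (gL s t))//.
apply: (@le_trans _ _ ((`|L| + 1) * `|s - t|)).
  by rewrite ler_wpM2r// (le_trans (ler_norm _))// lerDl.
rewrite mulrC -ler_pdivlMr//.
by near: t; apply: cvgr_dist_le; rewrite ?divr_gt0//; exact: cvg_id.
Unshelve. all: by end_near. Qed.

Lemma lipschitz_bump_restrict L g (A : set R) :
  lipschitz_bump L g -> `[-1, 1] `<=` A -> g \_ A = g \_ `[-1, 1].
Proof.
move=> [_ g0] A1; apply/funext => t; rewrite !patchE.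
case: ifPn => [_|]; case: ifPn => //.
- by rewrite mem_setE => tA; rewrite g0.
- by rewrite inE => /A1 /mem_set ->.
Qed.

Lemma lipschitz_bump_integrable L g (A : set R) :
  lipschitz_bump L g -> measurable A -> mu.-integrable A (EFin \o g).
Proof.
move=> gL mA; apply: (@integrableS _ _ _ mu setT) => //.
have : mu.-integrable `[-1, 1] (EFin \o g).
  apply: continuous_compact_integrable; first exact: segment_compact.
  exact/continuous_subspaceT/(lipschitz_bump_continuous gL).
have m1 : measurable (`[-1, 1]%classic : set R) by [].
move=> /(integrable_mkcond (mu := mu) (EFin \o g) m1); rewrite restrict_EFin.
by rewrite -(lipschitz_bump_restrict (A := setT) gL)// patch_setT.
Qed.

Let primitive g (v : R) := \int[mu]_(t in `]-oo, v]) g t.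

(** Starting the primitive at -oo makes it differentiable at every real point, so no lower endpoint
    needs separate care. *)
Lemma lipschitz_bump_MVT L g a b : lipschitz_bump L g -> a <= b ->
  exists2 c, c \in `[a, b] & primitive g b - primitive g a = g c * (b - a).
Proof.
move=> gL ab.
have dg (v : R) : is_derive v (1 : R) (primitive g) (g v).
  have v1 : v < v + 1 by rewrite ltrDl.
  have gc : {for v, continuous g} by exact: (lipschitz_bump_continuous gL).
  have gi := lipschitz_bump_integrable gL (measurable_itv (Interval -oo%O (BRight (v + 1)))).
  have [|dv <-] := continuous_FTC1 v1 gi _ gc; first exact: ltNyr.
  by rewrite derive1E; exact: DeriveDef.
apply: MVT_segment => //.
apply: continuous_subspaceT => v.
apply: differentiable_continuous; apply/derivable1_diffP.
by case: (dg v).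
Qed.

Let primitive_left L g (v : R) : lipschitz_bump L g -> v < -1 -> primitive g v = 0.
Proof.
move=> [_ g0] v1; rewrite /primitive Rintegral_mkcond.
have -> : g \_ `]-oo, v] = cst 0.
  apply/funext => t; rewrite patchE mem_setE in_itv/=.
  case: ifPn => // tv; rewrite g0//.
  by rewrite in_itv/= negb_and -!ltNge; apply/orP; left; lra.
by rewrite Rintegral_cst// mul0r.
Qed.

Let primitive_right L g (v : R) : lipschitz_bump L g -> 1 <= v ->
  primitive g v = \int[mu]_(t in `[-1, 1]) g t.
Proof.
move=> gL v1; rewrite /primitive (Rintegral_mkcond mu `]-oo, v]) (Rintegral_mkcond mu `[-1, 1]).
congr (\int[mu]_(_ in _) _).
rewrite -(lipschitz_bump_restrict (A := setT) gL)//.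
apply/funext => t; rewrite patch_setT patchE mem_setE in_itv/=.
case: ifPn => // tv; case: gL => _ -> //.
by rewrite in_itv/= negb_and -!ltNge; apply/orP; right; rewrite -ltNge in tv; lra.
Qed.

Lemma lipschitz_bump_ge0_integral0 L g : lipschitz_bump L g -> 0 <= L ->
  (forall t, 0 <= g t) -> \int[mu]_(t in `[-1, 1]) g t = 0 -> forall t, g t = 0.
Proof.
move=> gL L0 g0 int0 t.
(* The primitive is nondecreasing with equal limits, hence constant. *)
have mono a b : a <= b -> primitive g a <= primitive g b.
  move=> ab; have [c _] := lipschitz_bump_MVT gL ab.
  by rewrite -subr_ge0 => ->; rewrite mulr_ge0// subr_ge0.
have prim0 a : primitive g a = 0.
  apply/eqP; rewrite eq_le; apply/andP; split.
    rewrite -int0 -(primitive_right (v := Num.max 1 a) gL) ?le_max ?lexx//.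
    by apply: mono; rewrite le_max lexx orbT.
  rewrite -(primitive_left (v := Num.min (-2) a) gL) ?gt_min; last first.
    by apply/orP; left; lra.
  by apply: mono; rewrite ge_min lexx orbT.
(* A zero increment of the primitive gives a zero of [g] within [e / (L + 1)] of [t]; the Lipschitz
   bound then makes [|g t|] at most [e]. *)
apply/eqP; rewrite -normr_le0; apply/ler_addgt0Pr => e e0; rewrite add0r.
have L1 : 0 < L + 1 by rewrite ltr_wpDl.
have te : t < t + e / (L + 1) by rewrite ltrDl divr_gt0.
have [c] := lipschitz_bump_MVT gL (ltW te).
rewrite !prim0 subrr in_itv/= => /andP[c1 c2] /esym/eqP.
rewrite mulf_eq0 subr_eq0 (gt_eqF te) orbF => /eqP gc.
have := gL.1 t c; rewrite gc subr0 => /le_trans; apply.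
rewrite distrC ger0_norm ?subr_ge0//.
apply: (@le_trans _ _ ((L + 1) * (e / (L + 1)))).
  by rewrite ler_pM// ?subr_ge0 ?lerDl// lerBlDl.
by rewrite mulrC divfK// gt_eqF.
Qed.

(** The mean value theorem makes the error on each interval at most [L * del] times its length, and
    the intervals that count have total length at most [2 + 2 * del]. *)
Lemma riemann_sum_error L g del (n : nat) (u : nat -> R) :
  lipschitz_bump L g -> 0 <= L ->
  (forall j, (j < n)%N -> u j <= u j.+1 <= u j + del) ->
  u 0%N < -1 -> 1 <= u n ->
  `|\sum_(0 <= j < n) g (u j) * (u j.+1 - u j) - \int[mu]_(t in `[-1, 1]) g t|
    <= L * del * (2 + 2 * del).
Proof.
move=> gL L0 hu u0 un.
have n0 : (0 < n)%N by case: n un {hu} => // /le_lt_trans/(_ u0); lra.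
have del0 : 0 <= del by have /andP[h1 h2] := hu _ n0; lra.
have -> : \int[mu]_(t in `[-1, 1]) g t = primitive g (u n) - primitive g (u 0%N).
  by rewrite (primitive_left gL u0) (primitive_right gL un) subr0.
rewrite -(telescope_sumr (primitive g \o u) (leq0n n)) -sumrB.
(* Intervals that meet [-1, 1] lie in [-1 - del, 1 + del], so their lengths are
   bounded by a telescoping sum of clamped increments. *)
pose c t := Num.max (-1 - del) (Num.min t (1 + del)).
apply: (@le_trans _ _ (\sum_(0 <= j < n) L * del * (c (u j.+1) - c (u j)))).
  rewrite (le_trans (ler_norm_sum _ _ _))//.
  rewrite ler_sum_nat// => j /andP[_ jn].
  have /andP[h1 h2] := hu _ jn.
  have [z zu ->] := lipschitz_bump_MVT gL h1.
  have cmono : c (u j) <= c (u j.+1).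
    rewrite /c ge_max le_max lexx/= le_max; apply/orP; right.
    by rewrite le_min ge_min h1/= ge_min lexx orbT.
  rewrite in_itv/= in zu; have /andP[z1 z2] := zu.
  rewrite -mulrBl normrM (ger0_norm (_ : 0 <= u j.+1 - u j)) ?subr_ge0//.
  (* An interval that misses [-1, 1] has [g = 0] at both evaluation points; on any other one the
     clamp [c] changes nothing. *)
  have [out|] := boolP ((u j.+1 < -1) || (1 < u j)).
    have [_ g0] := gL.
    rewrite !g0 ?subrr ?normr0 ?mul0r ?mulr_ge0 ?subr_ge0//.
      by rewrite in_itv/= negb_and -!ltNge; move: out => /orP[?|?]; apply/orP; [left|right]; lra.
    by rewrite in_itv/= negb_and -!ltNge; move: out => /orP[?|?]; apply/orP; [left|right]; lra.
  rewrite negb_or -!leNgt => /andP[i1 i2].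
  have -> : c (u j.+1) - c (u j) = u j.+1 - u j.
    rewrite /c !minEle !maxEle.
    by congr (_ - _); repeat case: ifPn; rewrite -?ltNge; move=> *; lra.
  rewrite ler_wpM2r ?subr_ge0// (le_trans (gL.1 _ _))// ler_wpM2l//.
  by rewrite ler_norml; apply/andP; split; lra.
rewrite -mulr_sumr telescope_sumr// ler_wpM2l ?mulr_ge0//.
have h1 : c (u n) <= 1 + del by rewrite /c ge_max ge_min lexx orbT andbT; lra.
have h2 : - 1 - del <= c (u 0%N) by rewrite /c le_max lexx.
lra.
Qed.

End riemann_sums.

(** * Products of bumps and double Riemann sums for the kernel [|s - t|] *)

Section bumps.
Context (R : realType).
Local Notation mu := (@lebesgue_measure R).
Implicit Types (g : R -> R) (L : R).

(** The factor 3 is the largest distance from a point of [-1, 1] to the point 2, where [g]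
    vanishes. *)
Lemma lipschitz_bump_bounded L g t : 0 <= L -> lipschitz_bump L g -> `|g t| <= 3 * L.
Proof.
move=> L0 [gL g0]; have [|/g0 ->] := boolP (t \in `[-1, 1]); last first.
  by rewrite normr0 mulr_ge0.
rewrite in_itv/= => /andP[t1 t2].
have := gL t 2; rewrite (g0 2); last by rewrite in_itv/= negb_and -!ltNge; apply/orP; right; lra.
rewrite subr0 => /le_trans; apply; rewrite mulrC ler_wpM2r//.
by rewrite ler_norml; apply/andP; split; lra.
Qed.

Lemma lipschitz_bump_norm L g : lipschitz_bump L g ->
  lipschitz_bump L (fun t => `|g t|).
Proof.
move=> [gL g0]; split => [s t|t /g0 ->]; last by rewrite normr0.
exact: le_trans (ler_dist_dist _ _) (gL s t).
Qed.

(** [q] is controlled on [-1, 1] only, because monomials are not Lipschitz on the line. When just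
    one of the two points lies inside, the product vanishes at the other one and the increment of
    [g] alone gives the bound. *)
Lemma lipschitz_bumpM L M B g q : 0 <= L -> lipschitz_bump L g ->
  0 <= M -> 0 <= B ->
  (forall t, t \in `[-1, 1] -> `|q t| <= B) ->
  (forall s t, s \in `[-1, 1] -> t \in `[-1, 1] -> `|q s - q t| <= M * `|s - t|) ->
  lipschitz_bump (B * L + 3 * L * M) (fun t => q t * g t).
Proof.
move=> L0 gb M0 B0 qB qM; have [gL g0] := gb.
split => [s t|t /g0 ->]; last by rewrite mulr0.
have gs := lipschitz_bump_bounded s L0 gb; have gt := lipschitz_bump_bounded t L0 gb.
have half s' t' : s' \in `[-1, 1] -> t' \notin `[-1, 1] ->
    `|q s' * g s' - q t' * g t'| <= (B * L + 3 * L * M) * `|s' - t'|.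
  move=> s1 t1; rewrite (g0 t')// mulr0 subr0 normrM.
  have := gL s' t'; rewrite (g0 t')// subr0 => h.
  apply: (@le_trans _ _ (B * (L * `|s' - t'|))); first by rewrite ler_pM ?qB.
  by rewrite mulrA ler_wpM2r// lerDl !mulr_ge0.
have [s1|s1] := boolP (s \in `[-1, 1]); have [t1|t1] := boolP (t \in `[-1, 1]).
- rewrite (_ : _ - _ = q s * (g s - g t) + (q s - q t) * g t); last by ring.
  rewrite (le_trans (ler_normD _ _))// [leRHS]mulrDl !normrM lerD//.
    by rewrite -mulrA ler_pM ?qB.
  by rewrite mulrC -mulrA ler_pM ?qM.
- exact: half.
- by rewrite distrC (distrC s); exact: half.
- by rewrite !g0// !mulr0 subr0 normr0 mulr_ge0// addr_ge0 ?mulr_ge0.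
Qed.

Lemma distX_le (k : nat) (s t : R) : s \in `[-1, 1] -> t \in `[-1, 1] ->
  `|s ^+ k - t ^+ k| <= k%:R * `|s - t|.
Proof.
rewrite !in_itv/= -!ler_norml => s1 t1.
elim: k => [|k IH]; first by rewrite !expr0 subrr normr0 mul0r.
rewrite (_ : _ - _ = (s - t) * s ^+ k + t * (s ^+ k - t ^+ k)); last by rewrite !exprS; ring.
rewrite (le_trans (ler_normD _ _))// -natr1 [leRHS]mulrDl mul1r addrC !normrM lerD//.
  by rewrite (le_trans _ IH)// ler_piMl.
by rewrite ler_piMr// normrX exprn_ile1.
Qed.

Lemma lipschitz_bump_monomial L g k : 0 <= L -> lipschitz_bump L g ->
  lipschitz_bump (L + 3 * L * k%:R) (fun t => t ^+ k * g t).
Proof.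
move=> L0 gb; rewrite -{1}(mul1r L); apply: lipschitz_bumpM => //.
- move=> t; rewrite in_itv/= -ler_norml => t1.
  by rewrite normrX exprn_ile1.
- exact: distX_le.
Qed.

Lemma lipschitz_bump_dist L g s B : 0 <= L -> lipschitz_bump L g -> `|s| <= B ->
  lipschitz_bump ((B + 1) * L + 3 * L) (fun t => `|s - t| * g t).
Proof.
move=> L0 gb sB; rewrite -[in X in _ + X](mulr1 (3 * L)).
have B0 : 0 <= B by exact: le_trans sB.
apply: lipschitz_bumpM => //; first by rewrite addr_ge0.
- move=> t; rewrite in_itv/= -ler_norml => t1.
  by rewrite normr_id (le_trans (ler_normB _ _))// lerD.
- move=> t t' _ _; rewrite mul1r (le_trans (ler_dist_dist _ _))//.
  by rewrite opprB addrC addrA subrK distrC.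
Qed.

Lemma Rintegral_norm_le g B : mu.-integrable `[-1, 1] (EFin \o g) ->
  (forall t, t \in `[-1, 1] -> `|g t| <= B) ->
  `|\int[mu]_(t in `[-1, 1]) g t| <= 2 * B.
Proof.
move=> gi gB; have m1 : measurable (`[-1, 1]%classic : set R) by [].
rewrite (le_trans (le_normr_Rintegral _ _))//.
have len : mu `[-1, 1] = 2%:E.
  rewrite lebesgue_measure_itv/= lte_fin ifT; last lra.
  by rewrite -EFinB opprK.
apply: (@le_trans _ _ (\int[mu]_(t in `[-1, 1]) (cst B t))).
  apply: le_Rintegral => //.
  - exact: integrable_norm.
  - apply/integrableP; split; first by apply/measurable_EFinP.
    by rewrite /= integral_cst// [X in (_ * X)%E]len -EFinM ltry.
by rewrite Rintegral_cst// [X in fine X]len mulrC.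
Qed.

(** The integral of [|g|] is at most [2 * (3 * L)] and the Riemann error at most [4 * L] when
    [del <= 1]. This is the mass against which error terms are summed, however many design points
    lie in the window. *)
Lemma sum_norm_bump_le L (g : R -> R) del (n : nat) (u : nat -> R) :
  lipschitz_bump L g -> 0 <= L ->
  (forall j, (j < n)%N -> u j <= u j.+1 <= u j + del) ->
  u 0%N < -1 -> 1 <= u n -> 0 <= del <= 1 ->
  \sum_(0 <= j < n) `|g (u j)| * (u j.+1 - u j) <= 10 * L.
Proof.
move=> gb L0 hu u0 un /andP[del0 del1].
have gbn := lipschitz_bump_norm gb.
have h1 := riemann_sum_error gbn L0 hu u0 un.
have h2 : `|\int[mu]_(t in `[-1, 1]) `|g t| | <= 2 * (3 * L).
  apply: Rintegral_norm_le; first exact: lipschitz_bump_integrable gbn _.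
  by move=> t _; exact: lipschitz_bump_bounded gbn.
have h3 : L * del * (2 + 2 * del) <= 4 * L.
  rewrite (_ : 4 * L = L * 1 * 4); last by ring.
  by rewrite ler_pM ?mulr_ge0 ?addr_ge0 ?ler_pM//; lra.
by move: h1 h2; rewrite !ler_norml => /andP[_ h1] /andP[_ h2]; lra.
Qed.

(* The inner integral of the double integral defining [mat_A]. *)
Definition dist_potential g (s : R) := \int[mu]_(t in `[-1, 1]) (`|s - t| * g t).

(** Makes the outer sum of a double Riemann sum an ordinary one: the potential is Lipschitz because
    [s] enters only through [|s - t|]. In the constant, [12 * L2] bounds the potential on [-1, 1]
    and [6 * L2] is its Lipschitz constant. *)
Lemma lipschitz_bump_dist_potential L1 L2 (g1 g2 : R -> R) :
  0 <= L1 -> 0 <= L2 -> lipschitz_bump L1 g1 -> lipschitz_bump L2 g2 ->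
  exists2 L, 0 <= L & lipschitz_bump L (fun s => dist_potential g2 s * g1 s).
Proof.
move=> L10 L20 gb1 gb2.
have idist s : mu.-integrable `[-1, 1] (EFin \o (fun t => `|s - t| * g2 t)).
  exact: lipschitz_bump_integrable (lipschitz_bump_dist L20 gb2 (lexx _)) _.
exists (12 * L2 * L1 + 3 * L1 * (6 * L2)); first by rewrite addr_ge0 ?mulr_ge0.
apply: lipschitz_bumpM => //; rewrite ?mulr_ge0//.
- move=> s; rewrite in_itv/= => /andP[s1 s2].
  rewrite (_ : 12 * L2 = 2 * (2 * (3 * L2))); last by lra.
  apply: Rintegral_norm_le => // t; rewrite in_itv/= => /andP[t1 t2].
  rewrite normrM normr_id ler_pM//; last exact: lipschitz_bump_bounded gb2.
  by rewrite ler_norml; apply/andP; split; lra.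
- move=> s t _ _; rewrite /dist_potential -RintegralB//.
  rewrite (_ : 6 * L2 * _ = 2 * (`|s - t| * (3 * L2))); last by lra.
  apply: Rintegral_norm_le => [|v _].
    have := integrableB _ (idist s) (idist t). by apply.
  rewrite -mulrBl normrM ler_pM//; last exact: lipschitz_bump_bounded gb2.
  rewrite (le_trans (ler_dist_dist _ _))//.
  by rewrite opprB addrA subrK.
Qed.

(** The inner sum is a Riemann sum for the potential, uniformly in [s] in [-1, 1]. Replacing it
    costs [20 * L2 * del] times the mass [10 * L1] of the outer sum, which then approximates the
    integral of a bump. [C] is fixed before the partition. *)
Lemma double_riemann_sum_error L1 L2 (g1 g2 : R -> R) :
  0 <= L1 -> 0 <= L2 -> lipschitz_bump L1 g1 -> lipschitz_bump L2 g2 ->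
  exists C, forall del (n : nat) (u : nat -> R),
  (forall j, (j < n)%N -> u j <= u j.+1 <= u j + del) ->
  u 0%N < -1 -> 1 <= u n -> del <= 1 ->
  `|\sum_(0 <= j < n) \sum_(0 <= l < n) `|u j - u l| * g1 (u j) * g2 (u l) *
       ((u j.+1 - u j) * (u l.+1 - u l))
    - \int[mu]_(s in `[-1, 1]) (dist_potential g2 s * g1 s)| <= C * del.
Proof.
move=> L10 L20 gb1 gb2.
have [L3 L30 gb3] := lipschitz_bump_dist_potential L10 L20 gb1 gb2.
exists (20 * L2 * (10 * L1) + L3 * 4) => del n u hu u0 un del1.
have n0 : (0 < n)%N by case: n un {hu} => // /le_lt_trans/(_ u0); lra.
have del0 : 0 <= del by have /andP[h1 h2] := hu _ n0; lra.
pose S s := \sum_(0 <= l < n) (`|s - u l| * g2 (u l)) * (u l.+1 - u l).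
rewrite (_ : \sum_(0 <= j < n) _ = 
  \sum_(0 <= j < n) (S (u j) - dist_potential g2 (u j)) * g1 (u j) * (u j.+1 - u j) +
  \sum_(0 <= j < n) (dist_potential g2 (u j) * g1 (u j)) * (u j.+1 - u j)); last first.
  rewrite -big_split/=; apply: eq_bigr => j _.
  transitivity (S (u j) * g1 (u j) * (u j.+1 - u j)); last by ring.
  by rewrite /S !mulr_suml; apply: eq_bigr => l _; ring.
rewrite -addrA (le_trans (ler_normD _ _))// mulrDl lerD//; last first.
  rewrite (le_trans (riemann_sum_error gb3 L30 hu u0 un))//.
  rewrite (_ : L3 * 4 * del = L3 * del * 4); last by ring.
  by rewrite ler_wpM2l ?mulr_ge0//; lra.
have dS s : s \in `[-1, 1] -> `|S s - dist_potential g2 s| <= 20 * L2 * del.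
  rewrite in_itv/= -ler_norml => s1.
  have gb := lipschitz_bump_dist L20 gb2 s1.
  have L0 : 0 <= (1 + 1) * L2 + 3 * L2 by rewrite addr_ge0 ?mulr_ge0.
  rewrite (le_trans (riemann_sum_error gb L0 hu u0 un))//.
  rewrite (_ : 20 * L2 * del = ((1 + 1) * L2 + 3 * L2) * del * 4); last by ring.
  by rewrite ler_wpM2l ?mulr_ge0//; lra.
rewrite (le_trans (ler_norm_sum _ _ _))//.
apply: (@le_trans _ _ (\sum_(0 <= j < n) 20 * L2 * del * (`|g1 (u j)| * (u j.+1 - u j)))).
  apply: ler_sum_nat => j /andP[_ jn]; have /andP[h1 h2] := hu _ jn.
  rewrite normrM (ger0_norm (_ : 0 <= u j.+1 - u j)) ?subr_ge0// mulrA.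
  rewrite ler_wpM2r ?subr_ge0// normrM.
  have [/dS h|h] := boolP (u j \in `[-1, 1]); first by rewrite ler_wpM2r.
  by rewrite gb1.2// normr0 !mulr0.
rewrite -mulr_sumr (_ : 20 * L2 * _ * del = 20 * L2 * del * (10 * L1)); last by ring.
rewrite ler_wpM2l ?mulr_ge0//.
by apply: sum_norm_bump_le hu u0 un _; rewrite ?del0.
Qed.

(** Fubini on the whole plane: the integrand vanishes unless both points lie in [-1, 1], and is
    therefore dominated by [2 |g1| |g2|]. *)
Lemma double_integral_dist L1 L2 (g1 g2 : R -> R) :
  0 <= L1 -> 0 <= L2 -> lipschitz_bump L1 g1 -> lipschitz_bump L2 g2 ->
  \int[(mu \x mu)%E]_(w in `[-1, 1]%classic `*` `[-1, 1]%classic)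
      (`|w.1 - w.2| * g1 w.1 * g2 w.2) =
  \int[mu]_(s in `[-1, 1]) (dist_potential g2 s * g1 s).
Proof.
move=> L10 L20 gb1 gb2.
have [L3 L30 gb3] := lipschitz_bump_dist_potential L10 L20 gb1 gb2.
pose F (w : R * R) : R := `|w.1 - w.2| * g1 w.1 * g2 w.2.
have i1 := lipschitz_bump_integrable gb1 measurableT.
have i2 := lipschitz_bump_integrable gb2 measurableT.
have i12 : mu.-integrable setT (EFin \o (fun s => 2 * g1 s)).
  by have := integrableZl measurableT 2 i1.
have mg L (g : R -> R) : lipschitz_bump L g -> measurable_fun [set: R] g.
  by move=> gb; apply: continuous_measurable_fun; exact: lipschitz_bump_continuous gb.
have out w : w \notin `[-1, 1]%classic `*` `[-1, 1]%classic -> F w = 0.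
  rewrite /F notin_setE => /not_andP[] /negP h.
    by rewrite gb1.2// mulr0 mul0r.
  by rewrite gb2.2// mulr0.
have mF : measurable_fun [set: R * R] F.
  apply: measurable_funM; last by apply: measurableT_comp; [exact: mg gb2|].
  apply: measurable_funM; last by apply: measurableT_comp; [exact: mg gb1|].
  by apply: measurableT_comp => //; apply: measurable_funB.
have iF : (mu \x mu)%E.-integrable setT (EFin \o F).
  apply: (le_integrable measurableT _ _ (product_integrableM i12 i2)).
    exact/measurable_EFinP.
  move=> w _; rewrite /= lee_fin.
  have [|/out ->] := boolP (w \in `[-1, 1]%classic `*` `[-1, 1]%classic); last by rewrite normr0.
  rewrite inE => -[]/=; rewrite !in_itv/= => /andP[? ?] /andP[? ?].
  rewrite /F !normrM normr_id ler_wpM2r// ler_wpM2r// ger0_norm//.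
  by rewrite ler_norml; apply/andP; split; lra.
rewrite Rintegral_mkcond [RHS]Rintegral_mkcond.
rewrite -(lipschitz_bump_restrict (A := setT) gb3)// patch_setT.
rewrite (_ : _ \_ _ = F); last first.
  by apply/funext => w; rewrite patchE; case: ifPn => // /out.
rewrite /Rintegral -integral12_prod_meas1//; congr fine.
apply: eq_integral => s _; rewrite /fubini_F.
have gbs := lipschitz_bump_dist L20 gb2 (lexx `|s|).
have gsi := lipschitz_bump_integrable gbs measurableT.
have -> : dist_potential g2 s = \int[mu]_t (`|s - t| * g2 t).
  rewrite /dist_potential Rintegral_mkcond.
  by rewrite -(lipschitz_bump_restrict (A := setT) gbs)// patch_setT.
rewrite mulrC EFinM /Rintegral fineK ?integrable_fin_num//.
rewrite -integralZl//; apply: eq_integral => t _.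
by rewrite -EFinM /F/=; congr (_%:E); ring.
Qed.

End bumps.

(** * Local expansions of the regression and covariance functions *)

Section real_analysis.
Context (R : realType).
Implicit Types (A : set R) (g : R -> R).

(** At an interior point the restriction to [A] disappears near [y], and the substitution
    [z = y + t] turns one difference quotient into the other. *)
Lemma is_derive_within_interior A g (y l : R) :
  A° y -> is_derive_within A g y l -> is_derive y (1 : R) g l.
Proof.
move=> Ay gl.
suff cg : h^-1 *: ((g \o shift y) (h *: (1 : R)) - g y) @[h --> 0^'] --> l.
  by apply: DeriveDef; [exact: cvgP cg | exact: cvg_lim].
apply/cvgrPdist_le => e e0.
move/cvgrPdist_le : gl => /(_ e e0) gl.
have : \forall z \near y, z != y -> `|l - (g z - g y) / (z - y)| <= e.
  have : \forall z \near y, z != y -> A z -> `|l - (g z - g y) / (z - y)| <= e by [].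
  by apply: filterS2 Ay => z Az + zy; apply.
rewrite nbhs0P => near0; apply: filterS near0 => t h t0.
have yt : y + t - y = t by rewrite addrC addKr.
move: h; rewrite yt -(subr_eq0 _ y) yt => /(_ t0) /=.
by rewrite /GRing.scale/= mulr1 [t + y]addrC mulrC.
Qed.

Lemma itvoo_interior_cc (a b y : R) : a < y < b -> `[a, b]%classic° y.
Proof.
move=> /andP[ay yb]; have : y \in `]a, b[ by rewrite in_itv/= ay yb.
move=> /near_in_itvoo; apply: filterS => z.
by rewrite /= !in_itv/= => /andP[/ltW -> /ltW ->].
Qed.

Lemma within_continuous_interior (T U : topologicalType) (A : set T) (f : T -> U) t :
  {within A, continuous f} -> A° t -> {for t, continuous f}.
Proof.
move=> fc At; have := fc t.
by rewrite /prop_for /continuous_at -nbhs_subspace_interior.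
Qed.

(** On the open interval the induction hypothesis holds in a neighbourhood of [y], which is what
    differentiating it requires. *)
Lemma derive1n_within01 (D : nat -> R -> R) (k j : nat) (y : R) :
  (forall i z, (i < k)%N -> `[0, 1]%classic z ->
     is_derive_within `[0, 1] (D i) z (D i.+1 z)) ->
  (j <= k)%N -> 0 < y < 1 -> derive1n j (D 0%N) y = D j y.
Proof.
move=> dD; elim: j y => [|j IH] y jk y01; first by rewrite derive1n0.
rewrite derive1nS derive1E.
have y1 : `[0, 1]%classic y.
  by move: y01 => /andP[? ?]; rewrite /= in_itv/= !ltW.
have dj := is_derive_within_interior (itvoo_interior_cc y01) (dD _ _ jk y1).
rewrite (near_eq_derive (g := D j)); first by case: dj.
have : y \in `]0, 1[ by rewrite in_itv.
by move=> /near_in_itvoo; apply: filterS => z; rewrite in_itv/= => z01; rewrite IH// ltnW.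
Qed.

(** Both orders of [a] and [b] are covered, since the expansions below run on both sides of [x]. *)
Lemma MVT_dist_le g g' (a b c e : R) :
  (forall t : R, Num.min a b < t < Num.max a b -> is_derive t (1 : R) g (g' t)) ->
  (forall t : R, Num.min a b <= t <= Num.max a b -> {for t, continuous g}) ->
  (forall t, Num.min a b < t < Num.max a b -> `|g' t - c| <= e) ->
  `|g b - g a - c * (b - a)| <= e * `|b - a|.
Proof.
have main (s t : R) : s < t ->
    (forall r : R, s < r < t -> is_derive r (1 : R) g (g' r)) ->
    (forall r : R, s <= r <= t -> {for r, continuous g}) ->
    (forall r, s < r < t -> `|g' r - c| <= e) ->
    `|g t - g s - c * (t - s)| <= e * `|t - s|.
  move=> st dg cg ge.
  have dg' r : r \in `]s, t[ -> is_derive r (1 : R) g (g' r).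
    by rewrite in_itv/=; exact: dg.
  have cg' : {within `[s, t], continuous g}.
    by apply: continuous_in_subspaceT => r; rewrite inE/= in_itv/=; exact: cg.
  have [z zst ->] := MVT st dg' cg'.
  by rewrite -mulrBl normrM ler_wpM2r// ge//; rewrite in_itv/= in zst.
move=> dg cg ge; have [ab|ba|->] := ltgtP a b; last by rewrite !subrr mulr0 subr0 normr0 mulr0.
- by move: dg cg ge; rewrite (min_idPl (ltW ab)) (max_idPr (ltW ab)); exact: main.
- move: dg cg ge; rewrite (min_idPr (ltW ba)) (max_idPl (ltW ba)) => dg cg ge.
  have := main _ _ ba dg cg ge.
  by rewrite -normrN (distrC b a); congr (`|_| <= _); ring.
Qed.

(** Induction through the shifted family [D \o S]: the error [D 0 - T] vanishes at [x] and its
    derivative is the error of order [q] of the shifted family, so the mean value inequality adds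
    one factor [|y - x|]. The base case is continuity of the last function at [x]. *)
Lemma taylor_peano (D : nat -> R -> R) (q : nat) (x : R) :
  (\forall y \near x, forall j, (j < q)%N -> is_derive y (1 : R) (D j) (D j.+1 y)) ->
  {for x, continuous (D q)} ->
  forall e, 0 < e -> \forall y \near x,
  `|D 0%N y - \sum_(k < q.+1) D k x / k`!%:R * (y - x) ^+ k| <= e * `|y - x| ^+ q.
Proof.
elim: q D => [|q IH] D dD Dc e e0.
  move/cvgrPdist_le : Dc => /(_ e e0); apply: filterS => y.
  by rewrite big_ord_recl big_ord0 fact0 divr1 !expr0 !mulr1 addr0 distrC.
have dD' : \forall y \near x, forall j, (j < q)%N ->
    is_derive y (1 : R) (D j.+1) (D j.+2 y).
  by apply: filterS dD => y h j jq; exact: h.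
have := IH (D \o S) dD' Dc e e0.
move=> /(filterI dD) /nbhs_ballP[r r0 hr].
apply/nbhs_ballP; exists r => // y.
rewrite /ball/= => xy.
pose T z := \sum_(k < q.+2) D k x / k`!%:R * (z - x) ^+ k.
pose T' z := \sum_(k < q.+1) D k.+1 x / k`!%:R * (z - x) ^+ k.
have Tx : T x = D 0%N x.
  rewrite /T big_ord_recl/= subrr expr0 fact0 divr1 mulr1 big1 ?addr0// => i _.
  by rewrite expr0n/= mulr0.
have dT (z : R) : is_derive z (1 : R) T (T' z).
  have dpow (c : R) k : is_derive z (1 : R) (fun v => c * (v - x) ^+ k)
      (c * (k%:R * (z - x) ^+ k.-1)).
    have -> : (fun v => c * (v - x) ^+ k) = c \*: ((id - cst x) ^+ k : R -> R).
      by apply/funext => v; rewrite /= exprfctE.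
    by apply: is_derive_eq; rewrite subr0 [_ *: 1]mulr1.
  have -> : T = \sum_(k < q.+2) (fun v => D k x / k`!%:R * (v - x) ^+ k).
    by apply/funext => v; rewrite fct_sumE.
  apply: (is_derive_eq (is_derive_sum (fun k : 'I_q.+2 => dpow (D k x / k`!%:R) k))).
  rewrite big_ord_recl/= mul0r mulr0 add0r; apply: eq_bigr => k _.
  rewrite /bump/= add1n factS natrM mulrA; congr (_ * _).
  by rewrite invfM mulrA mulrAC divfK// pnatr_eq0.
have dDT (z : R) : `|x - z| < r -> is_derive z (1 : R) (D 0%N \- T) (D 1%N z - T' z).
  by move=> /hr[/(_ 0%N isT) dz _]; exact: is_deriveB.
have between z : Num.min x y <= z <= Num.max x y -> `|z - x| <= `|y - x|.
  by case: (ltgtP x y) => _ /andP[? ?]; rewrite !ler_norml; case: ler0P => *; lra.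
have := @MVT_dist_le (D 0%N \- T) (fun z => D 1%N z - T' z) x y 0 (e * `|y - x| ^+ q).
rewrite /= Tx subrr subr0 mul0r subr0 => h.
rewrite exprSr mulrA; apply: h => z zxy.
- apply: dDT; rewrite distrC (le_lt_trans (between z _))// ?(distrC y)//.
  by case/andP : zxy => /ltW -> /ltW ->.
- apply: differentiable_continuous; apply/derivable1_diffP.
  by case: (dDT z) => //; rewrite distrC (le_lt_trans (between z _))// distrC.
- have zxy' := between z _; rewrite subr0.
  have : `|z - x| <= `|y - x| by apply: between; case/andP : zxy => /ltW -> /ltW ->.
  move=> zy; have [|_ /= h2] := hr z.
    by rewrite /ball/= distrC (le_lt_trans zy)// distrC.
  rewrite (le_trans h2)// ler_pM2l//.
  by rewrite lerXn2r ?nnegrE.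
Qed.

(* From (y, z) with y <= z one reaches (x, x) inside the closed triangle above the
   diagonal, through (x, z) if z > x and through (y, x) otherwise; the mean value
   theorem is applied on each leg, whose interior avoids the diagonal. *)
Lemma covariance_expansion (rho : R -> R -> R) (x : R) :
  0 < x < 1 -> covariance_assumption rho ->
  (forall y z, y \in `[0, 1] -> z \in `[0, 1] -> rho y z = rho z y) ->
  forall e, 0 < e -> \forall r \near 0^'+, forall y z,
    `|y - x| <= r -> `|z - x| <= r ->
    `|rho y z - rho x x - (rho01_left rho x * (Num.min y z - x)
                         + rho01_right rho x * (Num.max y z - x))| <=
    e * (`|y - x| + `|z - x|).
Proof.
move=> x01 [rhoc [r10 [r01 [part _ _ lims]]]] sym e e0.
have [x0 x1] := andP x01.
have x01' : x \in `[0, 1] by rewrite in_itv/= !ltW.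
have [_ _ cb ca] := lims x x01'.
pose below := @square01 R `&` [set w | w.2 < w.1].
pose above := @square01 R `&` [set w | w.1 < w.2].
have inside (v : R) : 0 < v < 1 -> `[0, 1]%classic v.
  by move=> /andP[? ?]; rewrite /= in_itv/= !ltW.
have dr01 (y z : R) : 0 < y < 1 -> 0 < z < 1 -> y != z ->
    is_derive z (1 : R) (rho y) (r01 (y, z)).
  move=> y01 z01 yz; have [//|_ h] := part (y, z).
    by split => //=; split; exact: inside.
  exact: is_derive_within_interior (itvoo_interior_cc z01) h.
have near01 : \forall y \near x, 0 < y < 1.
  have : x \in `]0, 1[ by rewrite in_itv.
  by move=> /near_in_itvoo; apply: filterS => z; rewrite in_itv.
have ball_lim (S : set (R * R)) (l : R) : r01 @ within S (nbhs (x, x)) --> l ->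
    forall d, 0 < d -> exists2 s, 0 < s & forall y z, `|y - x| < s -> `|z - x| < s ->
      S (y, z) -> `|r01 (y, z) - l| <= d.
  move=> rl d d0; move/cvgrPdist_le : rl => /(_ d d0).
  move=> /nbhs_ballP[s s0 hs]; exists s => // y z yx zx Syz; rewrite distrC.
  by apply: hs => //; split; rewrite /ball/= distrC.
pose b := lim (r01 @ within below (nbhs (x, x))).
pose a := lim (r01 @ within above (nbhs (x, x))).
(* The limit along the vertical line through [x] coincides with the limit from the whole triangle,
   whose existence is assumed. *)
have leftE : rho01_left rho x = b.
  apply/cvg_lim => //; apply/cvgrPdist_le => d d0.
  have [s s0 hs] := ball_lim _ _ cb d d0.
  near=> y.
  have yx : y < x by near: y; exact: nbhs_left_lt.
  have ys : x - s < y by near: y; apply: nbhs_left_gt; rewrite ltrBlDr ltrDl.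
  have y0 : 0 < y by near: y; exact: nbhs_left_gt.
  have y01 : 0 < y < 1 by rewrite y0 (lt_trans yx).
  have dy := dr01 x y x01 y01 (negbT (gt_eqF yx)).
  rewrite derive1E derive_val distrC; apply: hs.
  - by rewrite subrr normr0.
  - by rewrite ltr_norml; apply/andP; split; lra.
  - by split => //=; split; exact: inside.
have rightE : rho01_right rho x = a.
  apply/cvg_lim => //; apply/cvgrPdist_le => d d0.
  have [s s0 hs] := ball_lim _ _ ca d d0.
  near=> y.
  have yx : x < y by near: y; exact: nbhs_right_gt.
  have ys : y < x + s by near: y; apply: nbhs_right_lt; rewrite ltrDl.
  have y1 : y < 1 by near: y; exact: nbhs_right_lt.
  have y01 : 0 < y < 1 by rewrite y1 (lt_trans x0).
  have dy := dr01 x y x01 y01 (negbT (lt_eqF yx)).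
  rewrite derive1E derive_val distrC; apply: hs.
  - by rewrite subrr normr0.
  - by rewrite ltr_norml; apply/andP; split; lra.
  - by split => //=; split; exact: inside.
have [sb sb0 hb] := ball_lim _ _ cb e e0.
have [sa sa0 ha] := ball_lim _ _ ca e e0.
near=> r => y z yr zr; rewrite leftE rightE.
have rb : r < sb by near: r; exact: nbhs_right_lt.
have ra : r < sa by near: r; exact: nbhs_right_lt.
have rx : r < x by near: r; exact: nbhs_right_lt.
have r1x : r < 1 - x by near: r; apply: nbhs_right_lt; rewrite subr_gt0.
have in01 v : `|v - x| <= r -> 0 < v < 1.
  by rewrite ler_norml => /andP[? ?]; apply/andP; split; lra.
have xr : `|x - x| <= r by rewrite subrr normr0 (le_trans _ yr).
have cts v t : `|v - x| <= r -> `|t - x| <= r -> {for t, continuous (rho v)}.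
  move=> vr tr.
  have : {for (v, t), continuous (fun w : R * R => rho w.1 w.2)}.
    apply: (within_continuous_interior rhoc).
    have := itvoo_interior_cc (in01 _ vr); have := itvoo_interior_cc (in01 _ tr).
    move=> nt nv; exists (`[0, 1]%classic, `[0, 1]%classic) => //=.
  rewrite /prop_for /continuous_at/= => c.
  have pc : (v, s) @[s --> t] --> (v, t).
    move=> S [[U V] [/= Uv Vt] UV]; apply: filterS Vt => s Vs.
    by apply: UV; split => //; exact: nbhs_singleton.
  exact: (cvg_comp _ (fun w : R * R => rho w.1 w.2) pc c).
(* Mean value inequality along a vertical segment whose open part avoids the diagonal; [cts] gives
   continuity up to an endpoint lying on it. *)
have seg s t (v l : R) : `|v - x| <= r -> `|s - x| <= r -> `|t - x| <= r ->
    (forall c, Num.min s t < c < Num.max s t -> v != c /\ `|r01 (v, c) - l| <= e) ->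
    `|rho v t - rho v s - l * (t - s)| <= e * `|t - s|.
  move=> vr sr tr hl.
  have btw w : Num.min s t <= w <= Num.max s t -> `|w - x| <= r.
    move: sr tr; rewrite !ler_norml; case: (ltgtP s t) => _ /andP[? ?] /andP[? ?] /andP[? ?]; lra.
  apply: (@MVT_dist_le _ (fun c => r01 (v, c))) => w wst.
  - apply: dr01; [exact: in01| |by case: (hl w wst)].
    by apply/in01/btw; case/andP: wst => /ltW -> /ltW ->.
  - by apply: cts => //; exact: btw.
  - by case: (hl w wst).
have y01 := in01 _ yr; have z01 := in01 _ zr.
have bnd v t : `|v - x| <= r -> `|t - x| <= r -> t < v -> `|r01 (v, t) - b| <= e.
  move=> vr tr tv; apply: hb; rewrite ?(le_lt_trans vr) ?(le_lt_trans tr)//.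
  by split => //=; split; apply/inside/in01.
have bnu v t : `|v - x| <= r -> `|t - x| <= r -> v < t -> `|r01 (v, t) - a| <= e.
  move=> vr tr tv; apply: ha; rewrite ?(le_lt_trans vr) ?(le_lt_trans tr)//.
  by split => //=; split; apply/inside/in01.
(* A leg in the first variable is reflected by [sym] into a vertical one below the diagonal, hence
   its slope [b]; a leg in the second variable stays above and has slope [a]. *)
have ordered v t : v <= t -> `|v - x| <= r -> `|t - x| <= r ->
    `|rho v t - rho x x - (b * (v - x) + a * (t - x))| <= e * (`|v - x| + `|t - x|).
  move=> vt vr tr.
  have v1 := inside _ (in01 _ vr); have t1 := inside _ (in01 _ tr).
  have btw s s' w : `|s - x| <= r -> `|s' - x| <= r ->
      Num.min s s' < w < Num.max s s' -> `|w - x| <= r.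
    rewrite !ler_norml; case: (ltgtP s s') => _ /andP[? ?] /andP[? ?] /andP[? ?]; lra.
  have [tx|xt] := leP t x.
    have h1 := seg x t v a vr xr tr _.
    have h2 := seg x v x b xr xr vr _.
    rewrite [leRHS]mulrDr (_ : _ - _ = (rho x v - rho x x - b * (v - x)) +
        (rho v t - rho v x - a * (t - x))); last first.
      by rewrite (sym x v)//; ring.
    rewrite (le_trans (ler_normD _ _))// lerD//.
      apply: h2 => w wv; have wr := btw _ _ _ xr vr wv.
      move: wv; rewrite (min_idPr _) ?(max_idPl _) ?(le_trans vt)// => /andP[wv wx].
      by rewrite gt_eqF//; split => //; exact: bnd.
    apply: h1 => w wt; have wr := btw _ _ _ xr tr wt.
    move: wt; rewrite (min_idPr _) ?(max_idPl _)// => /andP[wt wx].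
    have vw : v < w by exact: le_lt_trans wt.
    by rewrite lt_eqF//; split => //; exact: bnu.
  have h1 := seg x v t b tr xr vr _.
  have h2 := seg x t x a xr xr tr _.
  rewrite [leRHS]mulrDr (_ : _ - _ = (rho t v - rho t x - b * (v - x)) +
      (rho x t - rho x x - a * (t - x))); last first.
    by rewrite (sym t v)// (sym t x)//; ring.
  rewrite (le_trans (ler_normD _ _))// lerD//.
    apply: h1 => w wv; have wr := btw _ _ _ xr vr wv.
    have wt : w < t.
      by case/andP: wv => _ /lt_le_trans; apply; rewrite ge_max (ltW xt) vt.
    by rewrite gt_eqF//; split => //; exact: bnd.
  apply: h2 => w wt; have wr := btw _ _ _ xr tr wt.
  move: wt; rewrite (min_idPl (ltW xt)) (max_idPr (ltW xt)) => /andP[xw wt].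
  by rewrite lt_eqF//; split => //; exact: bnu.
have [yz|zy] := leP y z.
  exact: ordered.
rewrite [`|y - x| + _]addrC (sym y z) ?inside//.
by apply: ordered => //; exact: ltW.
Unshelve. all: by end_near. Qed.

End real_analysis.

(** * Weighted least squares *)

(** In regression terms this is [X' W X], where [X] has rows [(1, u_j, ..., u_j^p)] and
    [W = diag w]. In the same notation [weighted_moments] is [X' W y], and [cov_gram] is
    [X' W r W X], the middle factor of the sandwich covariance. *)
Definition gram (R : realType) (p N : nat) (w u : 'I_N -> R) : 'M[R]_p.+1 :=
  \matrix_(k, l) \sum_j w j * u j ^+ (k + l).

Definition weighted_moments (R : realType) (p N : nat) (w u y : 'I_N -> R) :
    'cV[R]_p.+1 :=
  \col_k \sum_j w j * u j ^+ k * y j.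

Definition cov_gram (R : realType) (p N : nat) (w u : 'I_N -> R)
    (r : 'I_N -> 'I_N -> R) : 'M[R]_p.+1 :=
  \matrix_(k, l) \sum_i \sum_j w i * w j * u i ^+ k * u j ^+ l * r i j.

Section least_squares.
Context (R : realType) (p N : nat).
Implicit Types (w u y : 'I_N -> R).

Lemma tr_gram w u : (gram p w u)^T = gram p w u.
Proof. by apply/matrixP => k l; rewrite !mxE; apply: eq_bigr => j _; rewrite addnC. Qed.

Lemma gram_mul w u (b : 'cV[R]_p.+1) k :
  (gram p w u *m b) k 0 =
  \sum_j w j * u j ^+ k * \sum_(l < p.+1) b l 0 * u j ^+ l.
Proof.
rewrite mxE; under eq_bigr do rewrite mxE mulr_suml.
rewrite exchange_big/=; apply: eq_bigr => j _.
by rewrite mulr_sumr; apply: eq_bigr => l _; rewrite exprD; ring.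
Qed.

(** The normal equations make the residual of [b0] orthogonal to all polynomials of degree at most
    [p], so any other [b] costs exactly a weighted sum of squares more. As [lp_coef] picks an
    arbitrary minimizer, uniqueness has to be shown as well, again from the invertible Gram
    matrix. *)
Lemma lp_coefE (K : R -> R) (h x kappa : R) (xd : 'I_N -> R) w y :
  let u j := (xd j - x) / h in
  0 < h -> 0 < kappa -> (forall t, 0 <= K t) ->
  (forall j, w j = kappa * K (u j)) -> gram p w u \in unitmx ->
  forall k, lp_coef K h x xd y p k 0 =
    h^-1 ^+ k * (invmx (gram p w u) *m weighted_moments p w u y) k 0.
Proof.
move=> u h0 kappa0 K0 wE Gu.
have hn0 : h != 0 by rewrite gt_eqF.
pose W j := h^-1 * K (u j).
have W0 j : 0 <= W j by rewrite mulr_ge0// invr_ge0 ltW.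
have WE j : W j = (h * kappa)^-1 * w j.
  by rewrite /W wE invfM -mulrA mulKf// gt_eqF.
(* Coefficients with respect to the powers of [u j] instead of those of [xd j - x]. *)
pose sc (b : 'cV[R]_p.+1) : 'cV[R]_p.+1 := \col_k (h ^+ k * b k 0).
have polyE (b : 'cV[R]_p.+1) j :
    \sum_(k < p.+1) b k 0 * (xd j - x) ^+ k = \sum_(k < p.+1) sc b k 0 * u j ^+ k.
  apply: eq_bigr => k _; rewrite mxE /u expr_div_n.
  have := expf_neq0 k hn0; move: (h ^+ k) => A A0; by field.
pose be := invmx (gram p w u) *m weighted_moments p w u y.
pose b0 : 'cV[R]_p.+1 := \col_k (h^-1 ^+ k * be k 0).
have scb0 : sc b0 = be.
  apply/colP => k; rewrite mxE [b0 _ _]mxE.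
  by rewrite mulrA -exprMn divff// expr1n mul1r.
pose r j := y j - \sum_(k < p.+1) be k 0 * u j ^+ k.
have normal (k : 'I_p.+1) : \sum_j W j * u j ^+ k * r j = 0.
  have := congr1 (fun M : 'cV[R]_p.+1 => M k 0) (mulKVmx Gu (weighted_moments p w u y)).
  rewrite gram_mul mxE => /eqP; rewrite eq_sym -subr_eq0 -sumrB => /eqP e.
  transitivity ((h * kappa)^-1 * 0); last by rewrite mulr0.
  rewrite -[X in _ = _ * X]e mulr_sumr; apply: eq_bigr => j _.
  by rewrite /r WE; ring.
pose D (b : 'cV[R]_p.+1) j := \sum_(k < p.+1) sc (b - b0) k 0 * u j ^+ k.
have wlsE b : wls K h x xd y b =
    wls K h x xd y b0 + \sum_j W j * D b j ^+ 2.
  have cross : \sum_j W j * r j * D b j = 0.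
    under eq_bigr do rewrite /D mulr_sumr.
    rewrite exchange_big/= big1// => k _.
    transitivity (sc (b - b0) k 0 * \sum_j W j * u j ^+ k * r j); last by rewrite normal mulr0.
    by rewrite mulr_sumr; apply: eq_bigr => j _; ring.
  rewrite -[RHS]subr0 -[X in _ = _ - X](mulr0 2) -[X in _ = _ - _ * X]cross.
  rewrite /wls mulr_sumr -big_split/= -sumrB; apply: eq_bigr => j _.
  rewrite !polyE scb0 -/(r j) -/(u j) -/(W j).
  have -> : \sum_(k < p.+1) sc b k 0 * u j ^+ k =
      \sum_(k < p.+1) be k 0 * u j ^+ k + D b j.
    rewrite -big_split/=; apply: eq_bigr => k _.
    by rewrite -scb0 -mulrDl; congr (_ * _); rewrite !mxE; ring.
  by rewrite opprD addrA -/(r j); ring.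
have minb0 : [set b | forall b' : 'cV[R]_p.+1, wls K h x xd y b <= wls K h x xd y b'] b0.
  move=> b' /=; rewrite (wlsE b') lerDl sumr_ge0// => j _.
  by rewrite mulr_ge0// sqr_ge0.
suff -> : lp_coef K h x xd y p = b0 by move=> k; rewrite mxE.
apply: xget_unique => // b /(_ b0); rewrite (wlsE b) gerDl => bmin.
(* A second minimizer has no excess; a vanishing sum of nonnegative terms vanishes termwise, and the
   Gram matrix then annihilates the rescaled difference. *)
have WD0 j : w j * D b j = 0.
  have WD2 i : 0 <= W i * D b i ^+ 2 by rewrite mulr_ge0// sqr_ge0.
  have : \sum_j W j * D b j ^+ 2 == 0.
    by rewrite eq_le bmin sumr_ge0.
  rewrite psumr_eq0// => /allP/(_ j); rewrite mem_index_enum => /(_ isT).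
  rewrite WE mulf_eq0 mulf_eq0 invr_eq0 mulf_eq0 (negbTE hn0) (gt_eqF kappa0)/=.
  by rewrite sqrf_eq0 -mulf_eq0 => /eqP.
have : gram p w u *m sc (b - b0) = 0.
  apply/colP => k; rewrite gram_mul mxE big1// => j _.
  by rewrite mulrAC -/(D b j) WD0 mul0r.
move=> /(congr1 (mulmx (invmx (gram p w u)))); rewrite mulKmx// mulmx0.
move=> /colP sc0; apply/colP => k; have := sc0 k; rewrite !mxE => /eqP.
by rewrite mulf_eq0 expf_eq0 (negbTE hn0) andbF/= subr_eq0 => /eqP.
Qed.

End least_squares.

Section estimator_moments.
Context d (T : measurableType d) (R : realType) (P : probability T R).

(** With an invertible Gram matrix the estimator is linear in the averaged data, with weights [a j]
    read off row [nu] of [G], so [variance_lincomb_indep] applies; the symmetry of [G] restores the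
    sandwich form. *)
Lemma lp_estimator_moments (p : nat) (nu : 'I_p.+1) (x : R)
    (m K : R -> R) (rho : R -> R -> R) (eps : nat -> R -> {RV P >-> R})
    (n N : nat) (xd w : 'I_N -> R) (h kappa : R) :
  let u j := (xd j - x) / h in
  let G := invmx (gram p w u) in
  let mhat v := lp_estimator K h x xd
    (mean_obs m (fun i t => eps i t : T -> R) n xd v) nu in
  iid_centered_errors eps rho ->
  (0 < n)%N -> 0 < h -> 0 < kappa -> (forall t, 0 <= K t) ->
  (forall j, xd j \in `[0, 1]) ->
  (forall j, w j = kappa * K (u j)) -> gram p w u \in unitmx ->
  ('E_P[mhat] = (nu`!%:R * h^-1 ^+ nu *
    ((e_ R nu)^T *m G *m weighted_moments p w u (m \o xd)) 0 0)%:E)%E /\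
  ('V_P[mhat] = (nu`!%:R ^+ 2 * h^-1 ^+ (2 * nu) * n%:R^-1 *
    ((e_ R nu)^T *m G *m cov_gram p w u (fun i j => rho (xd i) (xd j))
      *m G *m e_ R nu) 0 0)%:E)%E.
Proof.
move=> u G mhat [indep _ centered second] n0 h0 kappa0 K0 xd01 wE Gu.
have n0R : n%:R != 0 :> R by rewrite pnatr_eq0 -lt0n.
pose q j : R := \sum_(k < p.+1) G nu k * (w j * u j ^+ k).
pose a j := nu`!%:R * h^-1 ^+ nu * q j.
have eG (v : 'cV[R]_p.+1) : ((e_ R nu)^T *m G *m v) 0 0 = (G *m v) nu 0.
  by rewrite /e_ trmx_delta -rowE -row_mul mxE.
have Gw y : (G *m weighted_moments p w u y) nu 0 = \sum_j q j * y j.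
  rewrite mxE; under eq_bigr do rewrite mxE mulr_sumr.
  rewrite exchange_big/=; apply: eq_bigr => j _.
  by rewrite mulr_suml; apply: eq_bigr => k _; rewrite !mulrA.
have mhatE : mhat = (fun v => \sum_j a j * m (xd j) +
    \sum_j a j * (n%:R^-1 * \sum_(i < n) eps i (xd j) v)).
  apply/funext => v; rewrite /mhat /lp_estimator (lp_coefE _ h0 kappa0 K0 wE)//.
  rewrite -/G Gw mulrA mulr_sumr -big_split/=; apply: eq_bigr => j _.
  rewrite /a -!mulrA -!mulrDr; do 3 congr (_ * _).
  rewrite /mean_obs big_split/= sumr_const card_ord mulrDr.
  by rewrite -[in LHS](mulr_natl (m _)) mulKf.
have [|||EM VM] := @variance_lincomb_indep _ _ _ P n N a (\sum_j a j * m (xd j))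
   (fun i j => eps i (xd j)) (fun i j => rho (xd i) (xd j)) n0.
- by move=> i j; exact: centered.
- by move=> i j l; exact: second.
- move=> i i' j l A B ii' mA mB.
  exact: (mutually_independent_pair indep ii' (xd01 j) (xd01 l)).
rewrite mhatE EM VM; split.
  congr (_%:E); rewrite eG Gw mulr_sumr; apply: eq_bigr => j _.
  by rewrite /a !mulrA.
have GT : G^T = G by rewrite /G trmx_inv tr_gram.
congr (_%:E); rewrite -!mulmxA mulmxA eG (mulmxA G).
have -> : G *m e_ R nu = \col_k G nu k.
  by rewrite /e_ -colE; apply/colP => k; rewrite !mxE -[in LHS]GT mxE.
rewrite mxE; under [in RHS]eq_bigr do rewrite !mxE.
have -> : \sum_i \sum_j a i * a j * rho (xd i) (xd j) =
    nu`!%:R ^+ 2 * h^-1 ^+ (2 * nu) * \sum_i \sum_j q i * q j * rho (xd i) (xd j).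
  rewrite mulr_sumr; apply: eq_bigr => i _.
  rewrite mulr_sumr; apply: eq_bigr => j _.
  by rewrite /a mulnC exprM; ring.
rewrite mulrA (mulrC n%:R^-1); congr (_ * _).
transitivity (\sum_k \sum_l G nu k * G nu l * 
   cov_gram p w u (fun i j => rho (xd i) (xd j)) k l); last first.
  rewrite exchange_big/=; apply: eq_bigr => l _; rewrite mulr_suml.
  by apply: eq_bigr => k _; ring.
under [RHS]eq_bigr => k _.
  under eq_bigr => l _.
    rewrite mxE mulr_sumr; under eq_bigr do rewrite mulr_sumr. over.
  rewrite exchange_big/=. under eq_bigr do rewrite exchange_big/=. over.
rewrite [RHS]exchange_big/=; apply: eq_bigr => i _.
rewrite [RHS]exchange_big/=; apply: eq_bigr => j _.
rewrite /q big_distrlr/= mulr_suml; apply: eq_bigr => k _.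
by rewrite mulr_suml; apply: eq_bigr => l _; ring.
Qed.

End estimator_moments.

(** * Design points *)

Section design.
Context (R : realType).
Local Notation mu := (@lebesgue_measure R).

(** The order of the points is not part of [design_points]; it follows from [F] being strictly
    increasing, as [f] is positive. The constant is [1 / min f]. Points are read through [inord] as
    a sequence with [M = N - 1] gaps. *)
Lemma design_spacing (f : R -> R) (xd : forall N : nat, 'I_N -> R) :
  positive_density01 f -> design_points f xd ->
  exists2 c, 0 < c & forall M : nat, (0 < M)%N ->
    let X j := xd M.+1 (inord j) in
    [/\ X 0%N = 0, X M = 1 & forall j, (j < M)%N ->
      0 <= X j.+1 - X j <= c / M%:R /\
      exists2 xi, X j <= xi <= X j.+1 & M%:R^-1 = f xi * (X j.+1 - X j)].
Proof.
move=> [fc f0 f1] dp.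
pose F (v : R) := \int[mu]_(t in `[0, v]) f t.
have fi : mu.-integrable `[0, 1] (EFin \o f).
  by apply: continuous_compact_integrable => //; exact: segment_compact.
have F0 : F 0 = 0 by rewrite /F set_itv1 Rintegral_set1.
have F1 : F 1 = 1 by rewrite /F /Rintegral f1.
have FMVT s t : 0 <= s -> s <= t -> t <= 1 ->
    exists2 xi, s <= xi <= t & F t - F s = f xi * (t - s).
  move=> s0 st t1.
  have dF (v : R) : v \in `]s, t[ -> is_derive v (1 : R) F (f v).
    rewrite in_itv/= => /andP[sv vt].
    have v0 : 0 < v by exact: le_lt_trans s0 sv.
    have v1 : v < 1 by exact: lt_le_trans vt t1.
    have cv : {for v, continuous f}.
      by apply: (within_continuous_interior fc); apply: itvoo_interior_cc; rewrite v0.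
    have [dv <-] := continuous_FTC1_closed v1 fi v0 cv.
    by rewrite derive1E; exact: DeriveDef.
  have cF : {within `[s, t], continuous F}.
    apply: continuous_subspaceW (parameterized_integral_continuous ler01 fi).
    by apply: subset_itv; rewrite bnd_simp.
  have [xi xist ->] := MVT_segment st dF cF.
  by exists xi => //; rewrite in_itv in xist.
have [a a01 fa] := EVT_min ler01 fc.
have fa0 : 0 < f a by exact: f0.
exists (f a)^-1; first by rewrite invr_gt0.
move=> M M0 X.
have MR : 0 < M%:R :> R by rewrite ltr0n.
have X01 j : 0 <= X j <= 1.
  by have [] := dp M.+1 (inord j) M0; rewrite in_itv.
have FX j : (j <= M)%N -> F (X j) = j%:R / M%:R.
  by move=> jM; have [_] := dp M.+1 (inord j) M0; rewrite inordK.
have Finj s t : 0 <= s -> s <= t -> t <= 1 -> F s = F t -> s = t.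
  move=> s0 st t1 Fst; have [xi /andP[h1 h2]] := FMVT s t s0 st t1.
  rewrite Fst subrr => /esym/eqP; rewrite mulf_eq0 gt_eqF/=.
    by rewrite subr_eq0 => /eqP.
  by rewrite f0// in_itv/= (le_trans s0)//= (le_trans h2).
split.
- have /andP[h0 h1] := X01 0%N; apply/esym/Finj => //.
  by rewrite F0 FX// mul0r.
- have /andP[h0 h1] := X01 M; apply/Finj => //.
  by rewrite F1 FX// divff// gt_eqF.
move=> j jM.
have /andP[a0 a1] := X01 j; have /andP[b0 b1] := X01 j.+1.
have dF : F (X j.+1) - F (X j) = M%:R^-1.
  by rewrite !FX// ?(ltnW jM)// -mulrBl -natr1 addrAC subrr add0r mul1r.
have incr : X j <= X j.+1.
  rewrite leNgt; apply/negP => lt; have [xi /andP[h1 h2]] := FMVT _ _ b0 (ltW lt) a1.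
  rewrite -opprB dF => e.
  have : 0 < f xi * (X j - X j.+1).
    by rewrite mulr_gt0 ?subr_gt0// f0// in_itv/= (le_trans b0)//= (le_trans h2).
  by rewrite -e oppr_gt0 invr_lt0 ltNge ler0n.
have [xi xiX e] := FMVT _ _ a0 incr b1.
split; last by exists xi => //; rewrite -e.
rewrite subr_ge0 incr/= ler_pdivlMl//.
have fxi : f a <= f xi.
  by case/andP: xiX => h1 h2; rewrite fa// in_itv/= (le_trans a0)//= (le_trans h2).
have := ler_wpM2r (_ : 0 <= X j.+1 - X j) fxi; rewrite subr_ge0 => /(_ incr).
by rewrite -e dF.
Qed.

(** Equal weights [1 / (M h)] become lengths of partition intervals, at the price of a density
    [phi]. A gap between design points is at most [c / M], hence at most [e1 h^2] once
    [1 / (M h^2) < e1 / c]; after division by [h] the mesh of [u] is at most [e1 h]. *)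
Lemma design_weights (f : R -> R) (xd : forall N : nat, 'I_N -> R) (x f1 : R) :
  positive_density01 f -> design_points f xd -> 0 < x < 1 ->
  (forall e, 0 < e -> \forall y \near x,
     `|f y - f x - f1 * (y - x)| <= e * `|y - x|) ->
  forall e, 0 < e -> exists2 tau, 0 < tau & forall (M : nat) (h : R),
    (0 < M)%N -> 0 < h -> h < tau -> (M%:R * h ^+ 2)^-1 < tau ->
    let u j := (xd M.+1 (inord j) - x) / h in
    exists phi : nat -> R,
    [/\ u 0%N < -1, 1 < u M,
        forall j, (j < M)%N -> u j <= u j.+1 <= u j + e * h,
        forall j, (j < M)%N -> (M%:R * h)^-1 = phi j * (u j.+1 - u j) &
        forall j, (j < M)%N -> `|u j| <= 1 ->
          `|phi j - f x - h * f1 * u j| <= e * h].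
Proof.
move=> fd dp x01 df e e0; have [x0 x1] := andP x01.
have [c c0 hc] := design_spacing fd dp.
have k0 : 0 < `|f1| + 2 by rewrite ltr_pwDr.
(* The expansion of [f] at [xi j] costs at most [e1 * (2 * h)], and moving [xi j] to [X j] at most
   [|f1| * (e1 * h)]; this choice keeps the total below [e * h]. *)
pose e1 := Num.min 1 (e / (`|f1| + 2)).
have e10 : 0 < e1 by rewrite lt_min ltr01 divr_gt0.
have e11 : e1 <= 1 by rewrite ge_min lexx.
have e1e : e1 * (`|f1| + 2) <= e by rewrite -ler_pdivlMr// ge_min lexx orbT.
have [r /= r0 hr] := (nbhs_ballP _ _).1 (df e1 e10).
(* [r / 2] keeps [xi j], which is within [2 h] of [x], in the ball where the expansion of [f] holds;
   [x] and [1 - x] put the window inside (0, 1); [e1 / c] governs the mesh. *)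
exists (Num.min (Num.min 1 (r / 2)) (Num.min (Num.min x (1 - x)) (e1 / c))).
  by rewrite !lt_min ltr01 x0 subr_gt0 x1 !divr_gt0.
move=> M h M0 h0.
rewrite !lt_min => /andP[/andP[h1 hr2] /andP[/andP[hx h1x] _]].
move=> /andP[_ /andP[_ Mh]].
pose u j := (xd M.+1 (inord j) - x) / h.
have MR : 0 < M%:R :> R by rewrite ltr0n.
have [X0 XM hX] := hc M M0.
pose X j := xd M.+1 (inord j).
have hn0 : h != 0 by rewrite gt_eqF.
have xu j : X j = x + h * u j by rewrite /u mulrC divfK// addrC subrK.
have du j : u j.+1 - u j = (X j.+1 - X j) / h.
  by rewrite /u -mulrBl opprB addrA subrK.
have mesh j : (j < M)%N -> X j.+1 - X j <= e1 * h * h.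
  move=> jM; have [/andP[_ h2] _] := hX j jM; rewrite (le_trans h2)//.
  have -> : c / M%:R = ((M%:R * h ^+ 2)^-1 * c) * (h * h) by field; rewrite hn0 gt_eqF.
  by rewrite -[leRHS]mulrA ler_wpM2r ?mulr_ge0 ?(ltW h0)// -ler_pdivlMr// ltW.
(* One mean value point is selected per gap; for [j < M] such a point exists, so the default 0 is
   not reached. *)
pose xi j := xget 0 [set v | X j <= v <= X j.+1 /\ M%:R^-1 = f v * (X j.+1 - X j)].
have xiP j : (j < M)%N -> X j <= xi j <= X j.+1 /\ M%:R^-1 = f (xi j) * (X j.+1 - X j).
  move=> jM; rewrite /xi; have [_ [v v1 v2]] := hX j jM.
  by case: xgetP => [w -> //|/(_ v)]; case.
exists (f \o xi); split.
- by rewrite /u X0 ltr_pdivrMr// sub0r; lra.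
- by rewrite /u XM ltr_pdivlMr// mul1r.
- move=> j jM; have [/andP[h3 _] _] := hX j jM.
  rewrite -subr_ge0 du divr_ge0 ?(ltW h0)//= -lerBlDl du ler_pdivrMr//.
  rewrite (le_trans (mesh _ jM))// ler_wpM2r ?(ltW h0)// ler_wpM2r ?(ltW h0)//.
  rewrite (le_trans _ e1e)// ler_peMr ?(ltW e10)//.
  by have := normr_ge0 f1; lra.
- move=> j jM; have [_] := xiP _ jM; rewrite du mulrA => <-.
  by rewrite invfM.
- move=> j jM uj; have [/andP[h3 h4] _] := xiP _ jM.
  have msh := mesh _ jM.
  have d1 : `|xi j - X j| <= e1 * h * h by rewrite ger0_norm ?subr_ge0//; lra.
  have d2 : `|X j - x| <= h.
    by rewrite xu addrC addKr normrM (gtr0_norm h0) ler_piMr// ltW.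
  have hh : e1 * h * h <= h.
    by rewrite ler_piMl ?(ltW h0)// mulr_ile1 ?(ltW h0) ?(ltW e10) ?(ltW h1).
  have d3 : `|xi j - x| <= 2 * h.
    by rewrite (_ : xi j - x = (xi j - X j) + (X j - x)) ?(le_trans (ler_normD _ _))//; [lra|ring].
  have := hr (xi j); rewrite /ball/= distrC (le_lt_trans d3); last lra.
  move=> /(_ isT) h5.
  rewrite (_ : _ - _ = (f (xi j) - f x - f1 * (xi j - x)) + f1 * (xi j - X j)); last first.
    by rewrite /= -/(u j) xu; ring.
  rewrite (le_trans (ler_normD _ _))//.
  apply: (@le_trans _ _ (e1 * (2 * h) + `|f1| * (e1 * h))).
    apply: lerD; first by rewrite (le_trans h5)// ler_wpM2l// ltW.
    rewrite normrM ler_wpM2l// (le_trans d1)//.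
    by rewrite ler_piMr ?mulr_ge0 ?ltW.
  rewrite (_ : _ + _ = e1 * (`|f1| + 2) * h); last by ring.
  by rewrite ler_wpM2r// ltW.
Qed.

End design.

(** * Weighted moments of the design as Riemann sums *)

Section weights.
Context (R : realType).
Local Notation mu := (@lebesgue_measure R).

Lemma kernel_bump (K : R -> R) : kernel_assumption K ->
  exists2 L, 0 <= L & lipschitz_bump L K.
Proof.
move=> [lipK _ _ _ suppK].
have [L [_ hL]] := lipK.
exists (`|L| + 1); first by rewrite addr_ge0.
split => [s t|t].
  apply: (hL (`|L| + 1) _ (s, t)) => //.
  by rewrite (le_lt_trans (ler_norm L))// ltrDl.
apply: contraNeq => Kt.
suff : closure [set u | K u != 0] t by rewrite suppK.
exact: subset_closure.
Qed.

Definition design_u (xd : forall N : nat, 'I_N -> R) (x h : R) N (j : 'I_N) : R :=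
  (xd N j - x) / h.

Definition design_w (K : R -> R) (xd : forall N : nat, 'I_N -> R) (x h : R) N
    (j : 'I_N) : R :=
  (N.-1%:R * h)^-1 * K (design_u xd x h j).

Variables (f K : R -> R) (xd : forall N : nat, 'I_N -> R) (x f1 : R).
Hypotheses (fd : positive_density01 f) (dp : design_points f xd) (x01 : 0 < x < 1).
Hypothesis (df : forall e, 0 < e -> \forall y \near x,
     `|f y - f x - f1 * (y - x)| <= e * `|y - x|).
Hypothesis (Ka : kernel_assumption K).

(** There are [M.+1] points but only [M] gaps: the last point lies beyond the support of the kernel,
    so its term is dropped. *)
Let sum_design M h (G : R -> R) : (1 < (xd (inord M : 'I_M.+1) - x) / h) ->
  \sum_(j < M.+1) design_w K xd x h j * G (design_u xd x h j) =
  \sum_(0 <= j < M) (M%:R * h)^-1 * K ((xd (inord j : 'I_M.+1) - x) / h)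
     * G ((xd (inord j : 'I_M.+1) - x) / h).
Proof.
move=> uM; have [L _ [_ K0]] := kernel_bump Ka.
transitivity (\sum_(0 <= j < M.+1) (M%:R * h)^-1 * K ((xd (inord j : 'I_M.+1) - x) / h)
     * G ((xd (inord j : 'I_M.+1) - x) / h)).
  by rewrite big_mkord; apply: eq_bigr => j _; rewrite inord_val.
rewrite big_nat_recr//= K0 ?mulr0 ?mul0r ?addr0//.
by rewrite in_itv/= negb_and -!ltNge uM orbT.
Qed.

(** Writing [phi j] as [f x + h * f1 * u j] plus an error below [e1 * h] splits the sum into a
    Riemann sum for [mu_k], [h * f1] times one for [mu_(k+1)], and a rest controlled by
    [sum_norm_bump_le]. *)
Lemma design_moment (k : nat) e : 0 < e -> exists2 tau, 0 < tau &
  forall (M : nat) (h : R), (0 < M)%N -> 0 < h -> h < tau ->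
    (M%:R * h ^+ 2)^-1 < tau ->
  `|\sum_(j < M.+1) design_w K xd x h j * design_u xd x h j ^+ k
    - f x * kernel_moment K k - h * f1 * kernel_moment K k.+1| <= e * h.
Proof.
move=> e0; have [L L0 Kb] := kernel_bump Ka.
have gb1 := lipschitz_bump_monomial k L0 Kb.
have gb2 := lipschitz_bump_monomial k.+1 L0 Kb.
set L1 := L + _ in gb1; set L2 := L + _ in gb2.
have L10 : 0 <= L1 by rewrite addr_ge0 ?mulr_ge0.
have L20 : 0 <= L2 by rewrite addr_ge0 ?mulr_ge0.
(* With mesh [e1 * h <= 1] a Riemann error is at most [4 * L * (e1 * h)]; [10 * L1] comes from the
   rest, and the final 1 makes [C] positive. *)
pose C := 4 * `|f x| * L1 + 4 * `|f1| * L2 + 10 * L1 + 1.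
have C0 : 0 < C by rewrite ltr_pwDr// !addr_ge0 ?mulr_ge0.
pose e1 := Num.min 1 (e / C).
have e10 : 0 < e1 by rewrite lt_min ltr01 divr_gt0.
have e11 : e1 <= 1 by rewrite ge_min lexx.
have e1C : e1 * C <= e by rewrite -ler_pdivlMr// ge_min lexx orbT.
have [tau tau0 htau] := design_weights fd dp x01 df e10.
exists (Num.min tau 1); first by rewrite lt_min tau0 ltr01.
move=> M h M0 h0; rewrite !lt_min => /andP[ht h1] /andP[Mt _].
have [phi [u0 uM hu hphi happ]] := htau M h M0 h0 ht Mt.
rewrite (sum_design (fun v => v ^+ k))//.
set u := fun j => (xd (inord j : 'I_M.+1) - x) / h.
have del01 : 0 <= e1 * h <= 1.
  by rewrite mulr_ge0 ?(ltW e10) ?(ltW h0)//= mulr_ile1 ?(ltW e10) ?(ltW h0) ?(ltW h1).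
have [del0 del1] := andP del01.
have r1 := riemann_sum_error gb1 L10 hu u0 (ltW uM).
have r2 := riemann_sum_error gb2 L20 hu u0 (ltW uM).
have r3 := sum_norm_bump_le gb1 L10 hu u0 (ltW uM) del01.
rewrite -/(u _) in r1 r2 r3.
set S1 := \sum_(_ <= _ < _) _ in r1; set S2 := \sum_(_ <= _ < _) _ in r2.
set S3 := \sum_(_ <= _ < _) _ in r3.
have -> : \sum_(0 <= j < M) (M%:R * h)^-1 * K (u j) * u j ^+ k =
    f x * S1 + h * f1 * S2 + 
    \sum_(0 <= j < M) (phi j - f x - h * f1 * u j) * (u j ^+ k * K (u j) * (u j.+1 - u j)).
  rewrite /S1 /S2 !mulr_sumr -!big_split/=; apply: eq_big_nat => j /andP[_ jM].
  rewrite (hphi j jM) exprS -/(u j) -/(u j.+1); ring.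
set E3 := \sum_(_ <= _ < _) _.
have hE3 : `|E3| <= e1 * h * (10 * L1).
  rewrite (le_trans (ler_norm_sum _ _ _))//.
  apply: le_trans (ler_wpM2l del0 r3); rewrite mulr_sumr.
  apply: ler_sum_nat => j /andP[_ jM].
  have /andP[hu1 _] := hu _ jM.
  rewrite normrM [X in _ * X <= _]normrM (ger0_norm (_ : 0 <= u j.+1 - u j)) ?subr_ge0// mulrA.
  rewrite [leRHS]mulrA ler_wpM2r ?subr_ge0//.
  have [uj|uj] := boolP (`|u j| <= 1); first by rewrite ler_wpM2r// happ.
  rewrite Kb.2 ?mulr0 ?normr0 ?mulr0//.
  by rewrite in_itv/= -ler_norml.
have small : e1 * h * (2 + 2 * (e1 * h)) <= 4 * (e1 * h).
  by rewrite mulrC ler_wpM2r//; lra.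
rewrite -/(kernel_moment K k) in r1; rewrite -/(kernel_moment K k.+1) in r2.
rewrite (_ : _ - _ = f x * (S1 - kernel_moment K k) +
  h * f1 * (S2 - kernel_moment K k.+1) + E3); last by ring.
rewrite (le_trans (ler_normD _ _))//.
apply: (@le_trans _ _ (`|f x| * (L1 * (4 * (e1 * h))) + `|f1| * (L2 * (4 * (e1 * h))) +
  e1 * h * (10 * L1))).
  rewrite lerD// (le_trans (ler_normD _ _))// lerD//.
    by rewrite normrM ler_wpM2l// (le_trans r1)// -mulrA ler_wpM2l.
  rewrite !normrM (gtr0_norm h0) ler_pM ?mulr_ge0 ?(ltW h0)//.
    by rewrite ler_piMl// ltW.
  by rewrite (le_trans r2)// -mulrA ler_wpM2l.
apply: (@le_trans _ _ (e1 * C * h)); last by rewrite ler_wpM2r// ltW.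
rewrite /C; have := mulr_ge0 (ltW e10) (ltW h0); nra.
Qed.

(** Accuracy [e] rather than [e * h] is enough, as this sum enters the variance with a factor [h].
    Hence [phi] is replaced by the constant [f x] at once, and [design_weights] is used at precision
    1. *)
Lemma design_double_moment (k l : nat) e : 0 < e -> exists2 tau, 0 < tau &
  forall (M : nat) (h : R), (0 < M)%N -> 0 < h -> h < tau ->
    (M%:R * h ^+ 2)^-1 < tau ->
  `|\sum_(i < M.+1) \sum_(j < M.+1) design_w K xd x h i * design_w K xd x h j *
      design_u xd x h i ^+ k * design_u xd x h j ^+ l *
      `|design_u xd x h i - design_u xd x h j|
    - f x ^+ 2 *
    \int[(mu \x mu)%E]_(w in `[-1, 1]%classic `*` `[-1, 1]%classic)
      (`|w.1 - w.2| * w.1 ^+ k * w.2 ^+ l * K w.1 * K w.2)| <= e.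
Proof.
move=> e0; have [L L0 Kb] := kernel_bump Ka.
have gb1 := lipschitz_bump_monomial k L0 Kb.
have gb2 := lipschitz_bump_monomial l L0 Kb.
set L1 := L + _ in gb1; set L2 := L + _ in gb2.
have L10 : 0 <= L1 by rewrite addr_ge0 ?mulr_ge0.
have L20 : 0 <= L2 by rewrite addr_ge0 ?mulr_ge0.
have [C0 hC0] := double_riemann_sum_error L10 L20 gb1 gb2.
have -> : \int[(mu \x mu)%E]_(w in `[-1, 1]%classic `*` `[-1, 1]%classic)
      (`|w.1 - w.2| * w.1 ^+ k * w.2 ^+ l * K w.1 * K w.2) =
   \int[(mu \x mu)%E]_(w in `[-1, 1]%classic `*` `[-1, 1]%classic)
      (`|w.1 - w.2| * (w.1 ^+ k * K w.1) * (w.2 ^+ l * K w.2)).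
  by apply: eq_Rintegral => w _; ring.
rewrite (double_integral_dist L10 L20 gb1 gb2).
set I := (\int[mu]_(_ in _) _).
pose th := 1 + `|f1|.
have th0 : 0 <= th by rewrite addr_ge0.
(* For [h < 1], [h * th * (2 * |f x| + th)] bounds [phi i * phi j - f x ^+ 2]; the factor 2 bounds
   [|u i - u j|], and the last two factors are the masses of the two bumps. *)
pose C1 := th * (2 * `|f x| + th) * 2 * (10 * L1) * (10 * L2).
have C10 : 0 <= C1 by rewrite !mulr_ge0 ?addr_ge0 ?mulr_ge0.
pose C := C1 + f x ^+ 2 * `|C0| + 1.
have Cgt0 : 0 < C by rewrite ltr_pwDr// addr_ge0// mulr_ge0// sqr_ge0.
have [tau tau0 htau] := design_weights fd dp x01 df ltr01.
exists (Num.min tau (Num.min 1 (e / C))); first by rewrite !lt_min tau0 ltr01 divr_gt0.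
move=> M h M0 h0; rewrite !lt_min => /andP[ht /andP[h1 he]] /andP[Mt _].
have [phi [u0 uM hu hphi happ]] := htau M h M0 h0 ht Mt.
set u := fun j => (xd (inord j : 'I_M.+1) - x) / h.
pose g1 t := t ^+ k * K t; pose g2 t := t ^+ l * K t.
have -> : \sum_(i < M.+1) \sum_(j < M.+1) design_w K xd x h i * design_w K xd x h j *
      design_u xd x h i ^+ k * design_u xd x h j ^+ l *
      `|design_u xd x h i - design_u xd x h j| =
   \sum_(0 <= i < M) \sum_(0 <= j < M) (phi i * phi j) *
     (`|u i - u j| * g1 (u i) * g2 (u j) * ((u i.+1 - u i) * (u j.+1 - u j))).
  transitivity (\sum_(i < M.+1) design_w K xd x h i * (design_u xd x h i ^+ k * 
     \sum_(j < M.+1) design_w K xd x h j *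
       (design_u xd x h j ^+ l * `|design_u xd x h i - design_u xd x h j|))).
    apply: eq_bigr => i _; rewrite !mulr_sumr; apply: eq_bigr => j _; ring.
  rewrite (sum_design (fun v => v ^+ k *
     \sum_(j < M.+1) design_w K xd x h j * (design_u xd x h j ^+ l * `|v - design_u xd x h j|)))//.
  apply: eq_big_nat => i /andP[_ iM].
  rewrite (sum_design (fun v => v ^+ l * `|(xd (inord i : 'I_M.+1) - x) / h - v|))//.
  rewrite !mulr_sumr; apply: eq_big_nat => j /andP[_ jM].
  rewrite -/(u i) -/(u j) {1}(hphi i iM) (hphi j jM).
  rewrite -/(u i) -/(u j) -/(u i.+1) -/(u j.+1) /g1 /g2; ring.
have r0 : 0 <= h <= 1 by rewrite !ltW.
have h2 j : (j < M)%N -> u j <= u j.+1 <= u j + h by move=> /hu; rewrite mul1r.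
have r1 := sum_norm_bump_le gb1 L10 h2 u0 (ltW uM) r0.
have r2 := sum_norm_bump_le gb2 L20 h2 u0 (ltW uM) r0.
have r3 := hC0 h M u h2 u0 (ltW uM) (ltW h1).
set S := \sum_(_ <= _ < _) _ in r3.
set S' := \sum_(_ <= _ < _) _.
have dphi j : (j < M)%N -> `|u j| <= 1 -> `|phi j - f x| <= h * th.
  move=> jM uj.
  rewrite (_ : phi j - f x = (phi j - f x - h * f1 * u j) + h * f1 * u j); last by ring.
  rewrite (le_trans (ler_normD _ _))// /th mulrDr mulr1 lerD//.
    by have := happ j jM uj; rewrite mul1r.
  by rewrite normrM [`|h * f1|]normrM (gtr0_norm h0) ler_piMr// mulr_ge0// ltW.
have dSS : `|S' - f x ^+ 2 * S| <= h * C1.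
  rewrite /S' /S mulr_sumr -sumrB.
  under eq_bigr do rewrite mulr_sumr -sumrB.
  apply: (@le_trans _ _ (\sum_(0 <= i < M) \sum_(0 <= j < M)
     (h * (th * (2 * `|f x| + th) * 2)) *
     ((`|g1 (u i)| * (u i.+1 - u i)) * (`|g2 (u j)| * (u j.+1 - u j))))).
    rewrite (le_trans (ler_norm_sum _ _ _))//; apply: ler_sum_nat => i /andP[_ iM].
    rewrite (le_trans (ler_norm_sum _ _ _))//; apply: ler_sum_nat => j /andP[_ jM].
    rewrite -mulrBl.
    have /andP[hi _] := h2 _ iM; have /andP[hj _] := h2 _ jM.
    have di : 0 <= u i.+1 - u i by rewrite subr_ge0.
    have dj : 0 <= u j.+1 - u j by rewrite subr_ge0.
    have [ui|ui] := boolP (`|u i| <= 1); last first.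
      rewrite /g1 Kb.2; last by rewrite in_itv/= -ler_norml.
      by rewrite !(mulr0, mul0r, normr0).
    have [uj|uj] := boolP (`|u j| <= 1); last first.
      rewrite /g2 Kb.2; last by rewrite in_itv/= -ler_norml.
      by rewrite !(mulr0, mul0r, normr0).
    have nrm (a b c d e' : R) : 0 <= d -> 0 <= e' ->
        `| `|a| * b * c * (d * e')| = `|a| * (`|b| * d * (`|c| * e')).
      by move=> d0 e0'; rewrite !normrM normr_id (ger0_norm d0) (ger0_norm e0'); ring.
    rewrite normrM nrm// [leLHS]mulrA ler_wpM2r//; first by rewrite !mulr_ge0.
    rewrite (_ : h * _ = (h * th * (2 * `|f x| + th)) * 2); last by ring.
    have ij2 : `|u i - u j| <= 2.
      by rewrite (le_trans (ler_normB _ _))//; lra.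
    rewrite ler_pM//.
    have d1 := dphi i iM ui; have d2 := dphi j jM uj.
    have d2' : `|phi j| <= `|f x| + th.
      rewrite (_ : phi j = f x + (phi j - f x)); last by ring.
      rewrite (le_trans (ler_normD _ _))// lerD// (le_trans d2)//.
      by rewrite ler_piMl// ltW.
    rewrite (_ : _ - _ = (phi i - f x) * phi j + f x * (phi j - f x)); last by ring.
    rewrite (le_trans (ler_normD _ _))// !normrM.
    apply: (@le_trans _ _ (h * th * (`|f x| + th) + `|f x| * (h * th))); last by nra.
    by rewrite lerD// ler_pM.
  under eq_bigr do rewrite -mulr_sumr.
  rewrite -mulr_sumr -big_distrlr/=.
  rewrite (_ : h * C1 = h * (th * (2 * `|f x| + th) * 2) * (10 * L1 * (10 * L2)));
    last by rewrite /C1; ring.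
  rewrite ler_wpM2l ?mulr_ge0 ?addr_ge0 ?mulr_ge0 ?(ltW h0)//.
  have sum0 (g : R -> R) : 0 <= \sum_(0 <= j < M) `|g (u j)| * (u j.+1 - u j).
    rewrite big_nat; apply: sumr_ge0 => j /andP[_ jM].
    by have /andP[hj _] := h2 _ jM; rewrite mulr_ge0// subr_ge0.
  by rewrite ler_pM.
rewrite (_ : _ - _ = (S' - f x ^+ 2 * S) + f x ^+ 2 * (S - I)); last by ring.
rewrite (le_trans (ler_normD _ _))//.
apply: (@le_trans _ _ (h * C1 + f x ^+ 2 * (`|C0| * h))).
  rewrite lerD// normrM (ger0_norm (sqr_ge0 _)) ler_wpM2l ?sqr_ge0//.
  by rewrite (le_trans r3)// ler_wpM2r ?(ltW h0)// ler_norm.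
move: he; rewrite ltr_pdivlMr// /C => /ltW; apply: le_trans.
by rewrite !mulrDr; lra.
Qed.

End weights.

(** * Moments of the kernel *)

Section moment_matrix.
Context (R : realType).
Local Notation mu := (@lebesgue_measure R).

Lemma lipschitz_bump_sum (I : Type) (r : seq I) (a : I -> R) (g : I -> R -> R) :
  (forall i, exists2 L, 0 <= L & lipschitz_bump L (g i)) ->
  (exists2 L, 0 <= L & lipschitz_bump L (fun t => \sum_(i <- r) a i * g i t)) /\
  \int[mu]_(t in `[-1, 1]) (\sum_(i <- r) a i * g i t) =
    \sum_(i <- r) a i * \int[mu]_(t in `[-1, 1]) g i t.
Proof.
move=> gb; elim: r => [|i r [[L L0 IHb] IHi]].
  split; first by exists 0 => //; split => [s t|t _]; rewrite !big_nil// subrr normr0 mul0r.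
  rewrite big_nil -[RHS](mul0r (fine (mu `[-1, 1]%classic))) -Rintegral_cst//.
  by apply: eq_Rintegral => t _; rewrite big_nil.
have [M M0 gbi] := gb i.
split.
  exists (`|a i| * M + L); first by rewrite addr_ge0 ?mulr_ge0.
  split => [s t|t t1]; rewrite !big_cons; last by rewrite gbi.2// IHb.2// mulr0 addr0.
  rewrite opprD addrACA (le_trans (ler_normD _ _))// mulrDl lerD//; last exact: IHb.1.
  by rewrite -mulrBr normrM -mulrA ler_wpM2l// gbi.1.
rewrite big_cons -IHi -RintegralZl//; last exact: lipschitz_bump_integrable gbi _.
rewrite -RintegralD//; last exact: lipschitz_bump_integrable IHb _.
  by apply: eq_Rintegral => t _; rewrite big_cons.
have := integrableZl _ (a i) (lipschitz_bump_integrable gbi _); apply => //.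
Qed.

(** The form is the integral of [q^2 K], with [q] the polynomial of coefficients [v]. If it is zero,
    [q^2 K] vanishes everywhere, so [q] vanishes on an interval where [K] does not, which its degree
    forbids unless [q = 0]. *)
Lemma kernel_moment_form_gt0 (K : R -> R) (p : nat) (v : 'I_p.+1 -> R) :
  kernel_assumption K ->
  \sum_k \sum_l v k * v l * kernel_moment K (k + l) = 0 -> forall k, v k = 0.
Proof.
move=> Ka; have [L L0 Kb] := kernel_bump Ka.
have [_ _ K0 _ suppK] := Ka.
rewrite pair_bigA/=.
pose g (kl : 'I_p.+1 * 'I_p.+1) t := t ^+ (kl.1 + kl.2) * K t.
have gb kl : exists2 L, 0 <= L & lipschitz_bump L (g kl).
  exists (L + 3 * L * (kl.1 + kl.2)%N%:R); first by rewrite addr_ge0 ?mulr_ge0.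
  exact: lipschitz_bump_monomial.
have [[M M0 hb]] := lipschitz_bump_sum (index_enum _) (fun kl => v kl.1 * v kl.2) gb.
move=> <- int0.
pose q := \poly_(k < p.+1) v (inord k).
have qE t : q.[t] = \sum_k v k * t ^+ k.
  by rewrite horner_poly; apply: eq_bigr => k _; rewrite inord_val.
have sE t : \sum_kl v kl.1 * v kl.2 * g kl t = q.[t] ^+ 2 * K t.
  rewrite expr2 qE big_distrlr/= pair_bigA/= mulr_suml; apply: eq_bigr => kl _.
  by rewrite /g exprD; ring.
have qK0 t : q.[t] ^+ 2 * K t = 0.
  rewrite -sE; apply: (lipschitz_bump_ge0_integral0 hb M0 _ int0) => s.
  by rewrite sE mulr_ge0// sqr_ge0.
have [t0 Kt0] : exists t0, K t0 != 0.
  have : closure [set u | K u != 0] (0 : R).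
    by rewrite suppK /= in_itv/=; apply/andP; split; lra.
  by move=> /(_ setT filterT) [t [/= ? _]]; exists t.
(* By the Lipschitz bound [K] cannot drop to 0 within distance [|K t0| / (L + 1)] of [t0]. *)
have [r r0 hr] : exists2 r, 0 < r & forall s, `|t0 - s| < r -> K s != 0.
  exists (`|K t0| / (L + 1)).
    by rewrite divr_gt0 ?normr_gt0// ltr_wpDl.
  move=> s; rewrite ltr_pdivlMr ?ltr_wpDl// => h; apply: contraTneq h => Ks.
  rewrite -leNgt; have := Kb.1 t0 s; rewrite Ks subr0 => /le_trans; apply.
  by rewrite mulrC ler_wpM2l// lerDl.
have q0 : q = 0.
  apply/eqP/negPn/negP => qn0.
  (* These give [p.+1] distinct roots strictly between [t0] and [t0 + r], one more than a nonzero
     [q] can have. *)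
  pose s (i : nat) : R := t0 + r / i.+2%:R.
  have sroot : all (root q) (map s (iota 0 p.+1)).
    apply/allP => _ /mapP[i _ ->]; rewrite rootE.
    have Ks : K (s i) != 0.
      apply: hr; rewrite /s opprD addNKr normrN gtr0_norm ?divr_gt0//.
      by rewrite ltr_pdivrMr// ltr_pMr// ltr1n.
    by have /eqP := qK0 (s i); rewrite mulf_eq0 (negbTE Ks) orbF sqrf_eq0.
  have suniq : uniq (map s (iota 0 p.+1)).
    rewrite map_inj_uniq ?iota_uniq// => i j /addrI /(mulfI (lt0r_neq0 r0)) /invr_inj /eqP.
    by rewrite eqr_nat => /eqP[].
  have := max_poly_roots qn0 sroot suniq.
  by rewrite size_map size_iota ltnNge size_poly.
move=> k; have := congr1 (fun P : {poly R} => P`_k) q0.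
by rewrite coef_poly ltn_ord inord_val coef0.
Qed.

Lemma mat_S_unit (K : R -> R) (p : nat) :
  kernel_assumption K -> mat_S K p \in unitmx.
Proof.
move=> Ka; rewrite -row_free_unit -kermx_eq0; apply/rowV0P => v /sub_kermxP vS.
apply/rowP => k; rewrite mxE; move: k.
apply: (kernel_moment_form_gt0 Ka).
have : (v *m mat_S K p *m v^T) 0 0 = 0 by rewrite vS mul0mx mxE.
rewrite mxE exchange_big/= => e; rewrite -[RHS]e; apply: eq_bigr => k _.
rewrite !mxE mulr_suml; apply: eq_bigr => l _.
by rewrite !mxE; ring.
Qed.

End moment_matrix.

(** The integrand is odd. In the variance this settles the case [p = 0], where matrix algebra alone
    does not remove the linear part. *)
Lemma kernel_moment1 (R : realType) (K : R -> R) :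
  kernel_assumption K -> kernel_moment K 1 = 0.
Proof.
move=> Ka; have [L L0 Kb] := kernel_bump Ka; have [_ symK _ _ _] := Ka.
have gb := lipschitz_bump_monomial 1 L0 Kb.
suff : kernel_moment K 1 = - kernel_moment K 1 by lra.
have gi := lipschitz_bump_integrable gb (measurable_itv `[(-1), 1]).
rewrite -[RHS]mulN1r -RintegralZl//.
rewrite /kernel_moment /Rintegral; congr fine.
have := @integration_by_substitution_oppr R (fun t => t ^+ 1 * K t) (-1) 1.
rewrite opprK => ->; first by apply: eq_integral => t _; rewrite /= symK !expr1 mulN1r mulNr.
- by lra.
- by apply: continuous_subspaceT; exact: lipschitz_bump_continuous gb.
Qed.

(** * Asymptotic expansions *)

Section entrywise_convergence.
Context (R : realType) (I : Type) (F : set_system I) {FF : Filter F}.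

(** Stated entry by entry, so that products and determinants reduce to limits of real functions. *)
Definition mx_cvg m n (A : I -> 'M[R]_(m, n)) (B : 'M[R]_(m, n)) : Prop :=
  forall i j, A z i j @[z --> F] --> B i j.

Lemma cvg_bigsum (J : Type) (r : seq J) (P : pred J) (g : J -> I -> R) (l : J -> R) :
  (forall j, P j -> g j z @[z --> F] --> l j) ->
  (\sum_(j <- r | P j) g j z) @[z --> F] --> \sum_(j <- r | P j) l j.
Proof. exact: (cvg_big (@add_continuous R)). Qed.

Lemma cvg_bigprod (J : Type) (r : seq J) (P : pred J) (g : J -> I -> R) (l : J -> R) :
  (forall j, P j -> g j z @[z --> F] --> l j) ->
  (\prod_(j <- r | P j) g j z) @[z --> F] --> \prod_(j <- r | P j) l j.
Proof. exact: (cvg_big (@mul_continuous R)). Qed.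

Lemma mx_cvg_near m n (A A' : I -> 'M[R]_(m, n)) B :
  (\forall z \near F, A z = A' z) -> mx_cvg A B -> mx_cvg A' B.
Proof.
move=> AA' AB i j; apply: cvg_trans (AB i j).
by apply: near_eq_cvg; apply: filterS AA' => z ->.
Qed.

Lemma mx_cvg_cst m n (B : 'M[R]_(m, n)) : mx_cvg (fun=> B) B.
Proof. by move=> i j; exact: cvg_cst. Qed.

Lemma mx_cvgB m n (A A' : I -> 'M[R]_(m, n)) B B' :
  mx_cvg A B -> mx_cvg A' B' -> mx_cvg (fun z => A z - A' z) (B - B').
Proof.
move=> AB AB' i j; rewrite !mxE; under eq_fun do rewrite !mxE.
exact: cvgB.
Qed.

Lemma mx_cvgZ m n (k : I -> R) (l : R) (A : I -> 'M[R]_(m, n)) B :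
  k z @[z --> F] --> l -> mx_cvg A B -> mx_cvg (fun z => k z *: A z) (l *: B).
Proof.
move=> kl AB i j; rewrite mxE; under eq_fun do rewrite mxE.
exact: cvgM.
Qed.

Lemma mx_cvgM m n q (A : I -> 'M[R]_(m, n)) (A' : I -> 'M[R]_(n, q)) B B' :
  mx_cvg A B -> mx_cvg A' B' -> mx_cvg (fun z => A z *m A' z) (B *m B').
Proof.
move=> AB AB' i j; rewrite mxE; under eq_fun do rewrite mxE.
by apply: cvg_bigsum => k _; exact: cvgM.
Qed.

Lemma cvg_det n (A : I -> 'M[R]_n) B : mx_cvg A B ->
  \det (A z) @[z --> F] --> \det B.
Proof.
move=> AB; apply: cvg_bigsum => s _.
by apply: cvgM; [exact: cvg_cst|apply: cvg_bigprod => i _; exact: AB].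
Qed.

(** Determinant and cofactors are polynomials in the entries, so Cramer's formula passes to the
    limit. It is available only eventually, because [invmx] of a singular matrix is the matrix
    itself. *)
Lemma mx_cvg_inv n (A : I -> 'M[R]_n) B : mx_cvg A B -> B \in unitmx ->
  (\forall z \near F, A z \in unitmx) /\ mx_cvg (fun z => invmx (A z)) (invmx B).
Proof.
move=> AB Bu; have dAB := cvg_det AB.
have dB : \det B != 0 by rewrite -unitfE.
have Au : \forall z \near F, A z \in unitmx.
  have dA : \forall z \near F, \det (A z) != 0 by exact: cvgr_neq0 dAB dB.
  by apply: filterS dA => z; rewrite unitmxE unitfE.
split => //; apply: (@mx_cvg_near _ _ (fun z => (\det (A z))^-1 *: \adj (A z))).
  by apply: filterS Au => z Az; rewrite /invmx Az.
rewrite /invmx Bu; apply: mx_cvgZ; first exact: cvgV.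
move=> i j; rewrite mxE; under eq_fun do rewrite mxE.
rewrite /cofactor; apply: cvgM; first exact: cvg_cst.
apply: cvg_det => k l; rewrite !mxE; under eq_fun do rewrite !mxE.
exact: AB.
Qed.

End entrywise_convergence.

#[local] Instance sizes_oo_filter : ProperFilter sizes_oo :=
  filter_prod_proper.

(** Translates the asymptotic regime into the thresholds [tau] of the design lemmas. *)
Lemma bandwidth_near (R : realType) (nu : nat) (h : nat -> nat -> R) :
  bandwidth_assumption nu h -> forall tau, 0 < tau ->
  \forall z \near sizes_oo, [/\ (0 < z.1)%N, (1 < z.2)%N, h z.1 z.2 < tau &
    (z.2.-1%:R * h z.1 z.2 ^+ 2)^-1 < tau].
Proof.
move=> [h0 hcvg Nh _] tau tau0.
have n1 : \forall z \near sizes_oo, (0 < z.1)%N.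
  exists ([set k | (0 < k)%N], setT); last by move=> z [].
  by split; [exact: nbhs_infty_gt | exact: filterT].
have n2 : \forall z \near sizes_oo, (1 < z.2)%N.
  exists (setT, [set k | (1 < k)%N]); last by move=> z [].
  by split; [exact: filterT | exact: nbhs_infty_gt].
have n3 : \forall z \near sizes_oo, h z.1 z.2 < tau by exact: cvgr_lt hcvg _ tau0.
(* The factor 2 absorbs the passage from [N] to [N - 1], as [N <= 2 (N - 1)] for [N > 1]. *)
have n4 : \forall z \near sizes_oo, 2 / tau < z.2%:R * h z.1 z.2 ^+ 2.
  by move/cvgryPgt : Nh => /(_ (2 / tau)).
near=> z; have z1 : (0 < z.1)%N by near: z.
have z2 : (1 < z.2)%N by near: z.
have z3 : h z.1 z.2 < tau by near: z.
have z4 : 2 / tau < z.2%:R * h z.1 z.2 ^+ 2 by near: z.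
split => //.
have hz := h0 z.1 z.2; have hz2 : 0 < h z.1 z.2 ^+ 2 by rewrite exprn_gt0.
have M0 : 0 < z.2.-1%:R :> R by rewrite ltr0n; move: z2; case: (z.2) => [|[]].
have NM : z.2%:R <= 2 * z.2.-1%:R :> R.
  by rewrite -natrM ler_nat; lia.
rewrite -[ltRHS]invrK ltf_pV2 ?posrE ?invr_gt0 ?mulr_gt0//.
have : 2 / tau < 2 * z.2.-1%:R * h z.1 z.2 ^+ 2.
  by rewrite (lt_le_trans z4)// ler_wpM2r// ltW.
by rewrite -mulrA ltr_pM2l.
Unshelve. all: by end_near. Qed.

(** * Limits of the weighted moments and of the Gram matrix; bias and variance remainders *)

Section asymptotics.
Context (R : realType).
Local Notation mu := (@lebesgue_measure R).
Variables (p : nat) (nu : 'I_p.+1) (f K : R -> R) (xd : forall N : nat, 'I_N -> R).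
Variables (x f1 : R) (h : nat -> nat -> R).
Hypotheses (fd : positive_density01 f) (dp : design_points f xd) (x01 : 0 < x < 1).
Hypothesis df : forall e, 0 < e -> \forall y \near x,
     `|f y - f x - f1 * (y - x)| <= e * `|y - x|.
Hypothesis Ka : kernel_assumption K.
Hypothesis bw : bandwidth_assumption nu h.

Let hz (z : nat * nat) : R := h z.1 z.2.
Let u (z : nat * nat) : 'I_z.2 -> R := design_u xd x (hz z) (N := z.2).
Let w (z : nat * nat) : 'I_z.2 -> R := design_w K xd x (hz z) (N := z.2).
Arguments u : clear implicits.
Arguments w : clear implicits.
Let mom k (z : nat * nat) := \sum_j w z j * u z j ^+ k.

Let hz0 z : 0 < hz z. Proof. by case: bw => h0 _ _ _; exact: h0. Qed.
Let hzn0 z : hz z != 0. Proof. by rewrite gt_eqF. Qed.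

Let fx0 : 0 < f x.
Proof. by case: fd => _ f0 _; case/andP: x01 => *; rewrite f0// in_itv/= !ltW. Qed.

Let fxn0 : f x != 0. Proof. by rewrite gt_eqF. Qed.

Lemma moment_first_order k :
  ((mom k z - f x * kernel_moment K k) / hz z) @[z --> sizes_oo]
    --> f1 * kernel_moment K k.+1.
Proof.
apply/cvgrPdist_le => e e0.
have [tau tau0 ht] := design_moment fd dp x01 df Ka k e0.
apply: filterS (bandwidth_near bw tau0) => z.
rewrite /mom /w /u /hz; case: z => n [|[|M]] [] // _ _ ht1 ht2 /=.
have h0 : 0 < h n M.+2 := hz0 (n, M.+2).
have := ht M.+1 (h n M.+2) isT h0 ht1 ht2.
set s := \sum_(_ < _) _ => H.
rewrite distrC (_ : _ - _ = (s - f x * kernel_moment K k -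
   h n M.+2 * f1 * kernel_moment K k.+1) / h n M.+2); last by field; rewrite gt_eqF.
by rewrite normrM normfV (gtr0_norm h0) ler_pdivrMr.
Qed.

Let h_cvg0 : hz z @[z --> sizes_oo] --> 0. Proof. by case: bw. Qed.

Lemma moment_cvg k : mom k z @[z --> sizes_oo] --> f x * kernel_moment K k.
Proof.
have lim : ((mom k z - f x * kernel_moment K k) / hz z * hz z + f x * kernel_moment K k)
    @[z --> sizes_oo] --> f1 * kernel_moment K k.+1 * 0 + f x * kernel_moment K k.
  apply: cvgD; last exact: cvg_cst.
  by apply: cvgM; [exact: moment_first_order|exact: h_cvg0].
rewrite mulr0 add0r in lim; apply: cvg_trans lim; apply: near_eq_cvg; near=> z.
by rewrite divfK// subrK.
Unshelve. all: by end_near. Qed.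

Let w_ge0 z j : 0 <= w z j.
Proof.
have [_ _ K0 _ _] := Ka.
by rewrite /w /design_w mulr_ge0// invr_ge0 mulr_ge0// ltW.
Qed.

Let w_out z j : 1 < `|u z j| -> w z j = 0.
Proof.
move=> uj; have [L _ [_ K0]] := kernel_bump Ka.
by rewrite /w /design_w K0 ?mulr0// in_itv/= -ler_norml -ltNge.
Qed.

Let mom0_near : \forall z \near sizes_oo, mom 0 z <= f x * kernel_moment K 0 + 1.
Proof. by apply: (cvgr_le _ (@moment_cvg 0)); rewrite ltrDl. Qed.

Let mom00 : 0 <= kernel_moment K 0.
Proof.
apply: Rintegral_ge0 => t _; rewrite expr0 mul1r.
by case: Ka.
Qed.

Let term_le z j k : w z j * `|u z j ^+ k| <= w z j.
Proof.
have [uj|/w_out ->] := leP `|u z j| 1; last by rewrite mul0r.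
by rewrite ler_piMr// normrX exprn_ile1.
Qed.

Lemma weighted_sum_cvg0 (r : forall z : nat * nat, 'I_z.2 -> R) k :
  (forall e, 0 < e -> \forall z \near sizes_oo, forall j : 'I_z.2,
     `|u z j| <= 1 -> `|r z j| <= e) ->
  (\sum_j w z j * u z j ^+ k * r z j) @[z --> sizes_oo] --> (0 : R).
Proof.
move=> hr; apply/cvgr0Pnorm_le => e e0.
pose B := f x * kernel_moment K 0 + 1.
have B0 : 0 < B by rewrite ltr_wpDl// mulr_ge0// ltW.
have r1 := hr (e / B) (divr_gt0 e0 B0).
apply: filterS2 r1 mom0_near => z rz mz.
rewrite (le_trans (ler_norm_sum _ _ _))//.
apply: (@le_trans _ _ (mom 0 z * (e / B))); last first.
  apply: le_trans (ler_wpM2r _ mz) _; first by rewrite divr_ge0// ltW.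
  by rewrite mulrC divfK// gt_eqF.
rewrite /mom mulr_suml; apply: ler_sum => j _.
rewrite expr0 mulr1 normrM [X in X * _]normrM (ger0_norm (w_ge0 j)).
have [uj|/w_out ->] := leP `|u z j| 1; last by rewrite !mul0r.
exact: ler_pM (mulr_ge0 (w_ge0 j) (normr_ge0 _)) (normr_ge0 _) (term_le j k) (rz j uj).
Qed.

Lemma weighted_double_sum_cvg0 (r : forall z : nat * nat, 'I_z.2 -> 'I_z.2 -> R) k l :
  (forall e, 0 < e -> \forall z \near sizes_oo, forall i j : 'I_z.2,
     `|u z i| <= 1 -> `|u z j| <= 1 -> `|r z i j| <= e) ->
  (\sum_i \sum_j w z i * w z j * u z i ^+ k * u z j ^+ l * r z i j)
    @[z --> sizes_oo] --> (0 : R).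
Proof.
move=> hr.
pose B := f x * kernel_moment K 0 + 1.
have B0 : 0 < B by rewrite ltr_wpDl// mulr_ge0// ltW.
have -> : (fun z : nat * nat =>
    \sum_i \sum_j w z i * w z j * u z i ^+ k * u z j ^+ l * r z i j) =
  (fun z => \sum_i w z i * u z i ^+ k *
     (\sum_j w z j * u z j ^+ l * (if `|u z i| <= 1 then r z i j else 0))).
  apply/funext => z; apply: eq_bigr => i _; rewrite mulr_sumr; apply: eq_bigr => j _.
  by case: leP => [_|/w_out ->]; [ring|rewrite !mul0r].
apply: (@weighted_sum_cvg0 (fun z i =>
  \sum_j w z j * u z j ^+ l * (if `|u z i| <= 1 then r z i j else 0))) => e e0.
have r1 := hr (e / B) (divr_gt0 e0 B0).
apply: filterS2 r1 mom0_near => z rz mz i ui; rewrite ui.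
rewrite (le_trans (ler_norm_sum _ _ _))//.
apply: (@le_trans _ _ (mom 0 z * (e / B))); last first.
  apply: le_trans (ler_wpM2r _ mz) _; first by rewrite divr_ge0// ltW.
  by rewrite mulrC divfK// gt_eqF.
rewrite /mom mulr_suml; apply: ler_sum => j _.
rewrite expr0 mulr1 normrM [X in X * _]normrM (ger0_norm (w_ge0 j)).
have [uj|/w_out ->] := leP `|u z j| 1; last by rewrite !mul0r.
exact: ler_pM (mulr_ge0 (w_ge0 j) (normr_ge0 _)) (normr_ge0 _) (term_le j l) (rz i j ui uj).
Qed.

Local Notation S := (mat_S K p).
Local Notation Si := (invmx (mat_S K p)).
Let M z := gram p (w z) (u z).
Let G z := invmx (M z).

Let Su : S \in unitmx. Proof. exact: mat_S_unit. Qed.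

Lemma gram_cvg : mx_cvg sizes_oo M (f x *: S).
Proof.
move=> k l; rewrite !mxE; under eq_fun do rewrite mxE.
exact: moment_cvg.
Qed.

Let fSu : f x *: S \in unitmx. Proof. by rewrite unitmxZ// unitfE. Qed.

Lemma gram_unit_near : \forall z \near sizes_oo, M z \in unitmx.
Proof. by have [] := mx_cvg_inv gram_cvg fSu. Qed.

Lemma gram_inv_cvg : mx_cvg sizes_oo G ((f x)^-1 *: Si).
Proof. by have [_] := mx_cvg_inv gram_cvg fSu; rewrite invmxZ. Qed.

Let C z : 'cV[R]_p.+1 := \col_k mom (p.+1 + k) z.
Let Ct z : 'cV[R]_p.+1 := \col_k mom (p.+2 + k) z.

(** Follows from the exact identity [G C - S^-1 c = G ((C - f(x) c) - (M - f(x) S) S^-1 c)]: after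
    division by [h], both inner differences have the limits given by [moment_first_order]. *)
Lemma gram_inv_first_order :
  mx_cvg sizes_oo (fun z => (hz z)^-1 *: (G z *m C z - Si *m vec_c K p))
    ((f1 / f x) *: (Si *m vec_c_tilde K p - Si *m mat_S_tilde K p *m Si *m vec_c K p)).
Proof.
pose D z := G z *m ((hz z)^-1 *: (C z - f x *: vec_c K p) -
   (hz z)^-1 *: (M z - f x *: S) *m (Si *m vec_c K p)).
apply: (@mx_cvg_near _ _ _ _ _ _ D).
  apply: filterS gram_unit_near => z Mu; rewrite /D -scalemxAl -scalerBr -scalemxAr.
  congr (_ *: _); rewrite !mulmxBr !mulmxBl.
  rewrite -!scalemxAl (mulmxA S) mulmxV// mul1mx (mulmxBr (G z)) (mulmxA (G z)) mulVmx// mul1mx.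
  by rewrite opprB addrA subrK.
rewrite (_ : (f1 / f x) *: _ = ((f x)^-1 *: Si) *m
   (f1 *: vec_c_tilde K p - f1 *: mat_S_tilde K p *m (Si *m vec_c K p))); last first.
  rewrite -scalemxAl -scalemxAl -scalerBr -scalemxAr scalerA mulrC mulmxBr.
  by rewrite !mulmxA.
apply: (mx_cvgM gram_inv_cvg); apply: mx_cvgB.
  move=> k j; rewrite !mxE; under eq_fun do rewrite !mxE mulrC.
  exact: moment_first_order.
apply: mx_cvgM; last exact: mx_cvg_cst.
move=> k j; rewrite !mxE; under eq_fun do rewrite !mxE mulrC.
exact: moment_first_order.
Qed.

Let mul11 (a b : 'M[R]_1) : (a *m b) 0 0 = a 0 0 * b 0 0.
Proof. by rewrite mxE big_ord1. Qed.

Let add11 (a b : 'M[R]_1) : (a + b) 0 0 = a 0 0 + b 0 0.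
Proof. by rewrite mxE. Qed.

Let sub11 (a b : 'M[R]_1) : (a - b) 0 0 = a 0 0 - b 0 0.
Proof. by rewrite !mxE. Qed.

Let scale11 k (a : 'M[R]_1) : (k *: a) 0 0 = k * a 0 0.
Proof. by rewrite mxE. Qed.

Let mx_cvg11 (A : nat * nat -> 'M[R]_1) B :
  mx_cvg sizes_oo A B -> A z 0 0 @[z --> sizes_oo] --> B 0 0.
Proof. by move=> AB; exact: AB. Qed.

Let mx_cvgMl m n q (B : 'M[R]_(m, n)) (A : nat * nat -> 'M[R]_(n, q)) A0 :
  mx_cvg sizes_oo A A0 -> mx_cvg sizes_oo (fun z => B *m A z) (B *m A0).
Proof. by move=> AA0; apply: mx_cvgM => //; exact: mx_cvg_cst. Qed.

(** The Taylor term of degree [p + 1] has to be followed to first order in [h], which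
    [gram_inv_first_order] provides; for the term of degree [p + 2] the limit suffices. *)
Lemma bias_remainder (m : R -> R) (d : nat -> R) :
  (forall e, 0 < e -> \forall y \near x,
    `|m y - \sum_(k < p.+3) d k / k`!%:R * (y - x) ^+ k| <= e * `|y - x| ^+ p.+2) ->
  let e := e_ R nu in let c := vec_c K p in let ct := vec_c_tilde K p in
  forall eps, 0 < eps -> \forall z \near sizes_oo,
  `|nu`!%:R * (hz z)^-1 ^+ nu *
      (e^T *m G z *m weighted_moments p (w z) (u z) (m \o @xd z.2)) 0 0 - d nu -
    (nu`!%:R * d p.+1 / p.+1`!%:R * (e^T *m Si *m c) 0 0 * hz z ^+ (p.+1 - nu) +
     nu`!%:R * (d p.+2 / p.+2`!%:R * (e^T *m Si *m ct) 0 0 +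
        d p.+1 / p.+1`!%:R * (f1 / f x) * ((e^T *m Si *m ct) 0 0 -
           (e^T *m Si *m mat_S_tilde K p *m Si *m c) 0 0)) * hz z ^+ (p.+2 - nu))|
  <= eps * `|hz z ^+ (p.+2 - nu)|.
Proof.
move=> taylor e c ct eps eps0.
pose a := d p.+1 / p.+1`!%:R; pose b := d p.+2 / p.+2`!%:R.
pose rr z (j : 'I_z.2) : R := (m (xd j) -
  \sum_(k < p.+3) d k / k`!%:R * (xd j - x) ^+ k) / hz z ^+ p.+2.
pose rv z : 'cV[R]_p.+1 := \col_k \sum_j w z j * u z j ^+ k * rr z j.
have xdE z (j : 'I_z.2) : xd j - x = hz z * u z j.
  by rewrite /u /design_u mulrC divfK.
have rv0 : mx_cvg sizes_oo rv 0.
  move=> k l; rewrite mxE; under eq_fun do rewrite mxE.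
  apply: weighted_sum_cvg0 => e1 e10.
  have [t /= t0 ht] := (nbhs_ballP _ _).1 (taylor e1 e10).
  apply: filterS (bandwidth_near bw t0) => z [_ _ hzt _] j uj.
  have := ht (xd j); rewrite /ball/= distrC xdE normrM (gtr0_norm (hz0 z)).
  have hu : hz z * `|u z j| <= hz z by rewrite ler_piMr// ltW.
  rewrite (le_lt_trans hu)// => /(_ isT) hm.
  rewrite /rr normrM normfV normrX (gtr0_norm (hz0 z)) ler_pdivrMr ?exprn_gt0//.
  rewrite xdE (le_trans hm)// ler_wpM2l ?(ltW e10)// lerXn2r ?nnegrE ?mulr_ge0 ?(ltW (hz0 z))//.
(* Taylor coefficients in the scaled variable: [G z *m (M z *m beta z)] returns [beta z], whose
   entry [nu] cancels the target [d nu] exactly. *)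
pose beta z : 'cV[R]_p.+1 := \col_k (d k / k`!%:R * hz z ^+ k).
have WE z : weighted_moments p (w z) (u z) (m \o @xd z.2) =
    M z *m beta z + (a * hz z ^+ p.+1) *: C z + (b * hz z ^+ p.+2) *: Ct z
    + hz z ^+ p.+2 *: rv z.
  apply/colP => k; rewrite [RHS]mxE [X in _ = X + _]mxE [X in _ = X + _ + _]mxE gram_mul.
  rewrite !mxE /mom !mulr_sumr -!big_split/=; apply: eq_bigr => j _.
  have -> : m (xd j) = \sum_(l < p.+1) d l / l`!%:R * (hz z * u z j) ^+ l +
     a * (hz z * u z j) ^+ p.+1 + b * (hz z * u z j) ^+ p.+2 + hz z ^+ p.+2 * rr z j.
    have -> : hz z ^+ p.+2 * rr z j =
        m (xd j) - \sum_(l < p.+3) d l / l`!%:R * (hz z * u z j) ^+ l.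
      by rewrite mulrC /rr divfK ?expf_neq0// xdE.
    rewrite [X in _ - X]big_ord_recr [X in _ - (X + _)]big_ord_recr/= -/a -/b; ring.
  have -> : \sum_(l < p.+1) beta z l 0 * u z j ^+ l =
     \sum_(l < p.+1) d l / l`!%:R * (hz z * u z j) ^+ l.
    by apply: eq_bigr => l _; rewrite mxE (exprMn _ (hz z)) mulrA.
  rewrite !(exprMn _ (hz z)) !exprD; ring.
pose X1 z := (e^T *m ((hz z)^-1 *: (G z *m C z - Si *m c))) 0 0.
pose X2 z := (e^T *m (G z *m Ct z)) 0 0.
pose X3 z := (e^T *m (G z *m rv z)) 0 0.
pose s1 := (e^T *m Si *m c) 0 0; pose s2 := (e^T *m Si *m ct) 0 0.
pose s3 := (e^T *m Si *m mat_S_tilde K p *m Si *m c) 0 0.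
have cX1 : X1 z @[z --> sizes_oo] --> f1 / f x * (s2 - s3).
  have -> : f1 / f x * (s2 - s3) = (e^T *m ((f1 / f x) *: (Si *m ct -
      Si *m mat_S_tilde K p *m Si *m c))) 0 0.
    by rewrite -scalemxAr mulmxBr !mulmxA scale11 sub11.
  exact/mx_cvg11/mx_cvgMl/gram_inv_first_order.
have cX2 : X2 z @[z --> sizes_oo] --> s2.
  have -> : s2 = (e^T *m (((f x)^-1 *: Si) *m (f x *: ct))) 0 0.
    by rewrite -scalemxAl -!scalemxAr scalerA mulVf// scale1r mulmxA.
  have cCt : mx_cvg sizes_oo Ct (f x *: ct); last first.
    exact/mx_cvg11/mx_cvgMl/(mx_cvgM gram_inv_cvg cCt).
  move=> k l; rewrite !mxE; under eq_fun do rewrite mxE.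
  exact: moment_cvg.
have cX3 : X3 z @[z --> sizes_oo] --> (0 : R).
  have -> : 0 = (e^T *m (((f x)^-1 *: Si) *m (0 : 'cV_p.+1))) 0 0 by rewrite !mulmx0 mxE.
  exact/mx_cvg11/mx_cvgMl/(mx_cvgM gram_inv_cvg rv0).
(* The whole error is [nu! * Q z * h^(p+2-nu)]; each statistic appears minus its limit. *)
pose Q z := a * (X1 z - f1 / f x * (s2 - s3)) + b * (X2 z - s2) + X3 z.
have cQ : nu`!%:R * Q z @[z --> sizes_oo] --> (0 : R).
  have -> : 0 = nu`!%:R * (a * (f1 / f x * (s2 - s3) - f1 / f x * (s2 - s3)) +
     b * (s2 - s2) + 0) :> R by ring.
  apply: cvgM; first exact: cvg_cst.
  apply: cvgD => //; apply: cvgD; (apply: cvgM; first exact: cvg_cst).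
    by apply: cvgB => //; exact: cvg_cst.
  by apply: cvgB => //; exact: cvg_cst.
move/cvgr0Pnorm_le : cQ => /(_ eps eps0).
apply: filterS2 gram_unit_near => z Mu Qe.
have -> : e^T *m G z *m weighted_moments p (w z) (u z) (m \o @xd z.2) =
   e^T *m beta z + (a * hz z ^+ p.+1) *: (e^T *m (G z *m C z)) +
   (b * hz z ^+ p.+2) *: (e^T *m (G z *m Ct z)) + hz z ^+ p.+2 *: (e^T *m (G z *m rv z)).
  by rewrite -mulmxA WE !mulmxDr -!scalemxAr (mulmxA (G z)) mulVmx// mul1mx.
have -> : e^T *m (G z *m C z) = hz z *: (e^T *m ((hz z)^-1 *: (G z *m C z - Si *m c))) +
    e^T *m Si *m c.
  by rewrite -scalemxAr scalerA mulfV// scale1r mulmxBr (mulmxA _ Si) subrK.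
rewrite !(add11, scale11) -/(X1 z) -/(X2 z) -/(X3 z) -/s1 -/s2 -/s3.
have -> : (e^T *m beta z) 0 0 = d nu / nu`!%:R * hz z ^+ nu.
  by rewrite /e /e_ trmx_delta -rowE !mxE.
rewrite -/a -/b.
have hp1 : hz z ^+ p.+1 = hz z ^+ nu * hz z ^+ (p.+1 - nu).
  by rewrite -exprD subnKC// ltnW.
have hp2 : hz z ^+ p.+2 = hz z ^+ nu * (hz z ^+ (p.+1 - nu) * hz z).
  by rewrite mulrA -hp1 -exprSr.
have hp3 : hz z ^+ (p.+2 - nu) = hz z ^+ (p.+1 - nu) * hz z.
  by rewrite -exprSr subSn// ltnW.
rewrite hp2 hp3 hp1 -/s1.
have fact0 : nu`!%:R != 0 :> R by rewrite pnatr_eq0 -lt0n fact_gt0.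
rewrite (_ : _ - _ = nu`!%:R * Q z * (hz z ^+ (p.+1 - nu) * hz z)).
  by rewrite normrM ler_wpM2r.
rewrite /Q exprVn.
have := expf_neq0 nu (hzn0 z).
move: (hz z ^+ nu) (hz z ^+ (p.+1 - nu)) (hz z) => A B H A0.
rewrite /a /b.
have : p.+1`!%:R != 0 :> R by rewrite pnatr_eq0 -lt0n fact_gt0.
have : p.+2`!%:R != 0 :> R by rewrite pnatr_eq0 -lt0n fact_gt0.
move: p.+1`!%:R p.+2`!%:R nu`!%:R fact0 => F1 F2 F3 F30 F20 F10.
by field; rewrite fxn0 F30 A0 F10 F20.
Qed.

(** A rank-one middle factor splits the sandwich into a product of two linear forms, so that the
    moment vector [s] enters only through [G *m s]. *)
Let quad_rank1 (H : 'M[R]_p.+1) (e a b : 'cV[R]_p.+1) : H^T = H ->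
  (e^T *m H *m (a *m b^T) *m H *m e) 0 0 =
  (e^T *m (H *m a)) 0 0 * (e^T *m (H *m b)) 0 0.
Proof.
move=> HT; rewrite (_ : _ *m e = (e^T *m (H *m a)) *m (b^T *m H *m e)); last first.
  by rewrite !mulmxA.
rewrite mul11; congr (_ * _).
transitivity ((e^T *m (H *m b))^T 0 0); last by rewrite mxE.
by rewrite !trmx_mul trmxK HT.
Qed.

(** The leading term has to be matched exactly: an error [o(1)] in it could swamp the second term,
    which is smaller by a factor [h]. What remains is [h] times quantities that converge. *)
Lemma variance_remainder (rho : R -> R -> R) (bl br : R) :
  (forall e, 0 < e -> \forall r \near 0^'+, forall y z,
    `|y - x| <= r -> `|z - x| <= r ->
    `|rho y z - rho x x - (bl * (Num.min y z - x) + br * (Num.max y z - x))| <=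
    e * (`|y - x| + `|z - x|)) ->
  let e := e_ R nu in
  forall eps, 0 < eps -> \forall z \near sizes_oo,
  `|nu`!%:R ^+ 2 * (hz z)^-1 ^+ (2 * nu) * z.1%:R^-1 *
      (e^T *m G z *m cov_gram p (w z) (u z) (fun i j => rho (xd i) (xd j))
         *m G z *m e) 0 0 -
    (nu`!%:R ^+ 2 * rho x x / (z.1%:R * hz z ^+ (2 * nu)) *
       (e^T *m Si *m mat_S_star K p *m Si *m e) 0 0 -
     nu`!%:R ^+ 2 / (z.1%:R * hz z ^ (2 * nu%:Z - 1)) * (bl - br) *
       (e^T *m Si *m mat_A K p *m Si *m e) 0 0)|
  <= eps * `|(z.1%:R * hz z ^ (2 * nu%:Z - 1))^-1|.
Proof.
move=> cov e eps eps0.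
have xdE z (j : 'I_z.2) : xd j - x = hz z * u z j.
  by rewrite /u /design_u mulrC divfK.
(* Minimum and maximum are half the sum minus or plus half the distance, so the slopes [bl] and [br]
   act as their mean on [u z i + u z j] and as minus half their difference on the distance. [eta] is
   the rest of the expansion, divided by [h]. *)
pose eta z (i j : 'I_z.2) : R := (rho (xd i) (xd j) - rho x x -
  hz z * ((bl + br) / 2 * (u z i + u z j) - (bl - br) / 2 * `|u z i - u z j|)) / hz z.
pose Ez z : 'M[R]_p.+1 := \matrix_(k, l)
  \sum_i \sum_j w z i * w z j * u z i ^+ k * u z j ^+ l * eta z i j.
pose Az z : 'M[R]_p.+1 := \matrix_(k, l) (2^-1 * \sum_i \sum_j w z i * w z j *
   u z i ^+ k * u z j ^+ l * `|u z i - u z j|).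
pose s z : 'cV[R]_p.+1 := \col_k mom k z.
pose s' z : 'cV[R]_p.+1 := \col_k mom k.+1 z.
have Ez0 : mx_cvg sizes_oo Ez 0.
  move=> k l; rewrite mxE; under eq_fun do rewrite mxE.
  apply: weighted_double_sum_cvg0 => e1 e10.
  have e20 : 0 < e1 / 2 by rewrite divr_gt0.
  have [t /= t0 ht] := (nbhs_ballP _ _).1 (cov _ e20).
  apply: filterS (bandwidth_near bw t0) => z [_ _ hzt _] i j ui uj.
  have uh v : `|v| <= 1 -> `|hz z * v| <= hz z.
    by move=> v1; rewrite normrM (gtr0_norm (hz0 z)) ler_piMr// ltW.
  have := ht (hz z); rewrite /ball/= sub0r normrN (gtr0_norm (hz0 z)).
  move=> /(_ hzt (hz0 z) (xd i) (xd j)); rewrite !xdE => /(_ (uh _ ui) (uh _ uj)).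
  have mm : bl * (Num.min (xd i) (xd j) - x) + br * (Num.max (xd i) (xd j) - x) =
     hz z * ((bl + br) / 2 * (u z i + u z j) - (bl - br) / 2 * `|u z i - u z j|).
    have [dij|dij] := leP (xd i) (xd j).
      rewrite !xdE ler0_norm; first by lra.
      by rewrite subr_le0 -(ler_pM2l (hz0 z)) -!xdE lerD2r.
    rewrite !xdE ger0_norm; first by lra.
    by rewrite subr_ge0 -(ler_pM2l (hz0 z)) -!xdE lerD2r ltW.
  rewrite mm => hm.
  rewrite /eta normrM normfV (gtr0_norm (hz0 z)) ler_pdivrMr// (le_trans hm)//.
  rewrite (_ : e1 * hz z = e1 / 2 * (hz z + hz z)); last by field.
  by rewrite ler_wpM2l ?(ltW e20)// lerD// uh.
have cAz : mx_cvg sizes_oo Az (f x ^+ 2 *: mat_A K p).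
  move=> k l; rewrite !mxE; under eq_fun do rewrite mxE.
  rewrite mulrCA; apply: cvgM; first exact: cvg_cst.
  apply/cvgrPdist_le => e1 e10.
  have [tau tau0 ht] := design_double_moment fd dp x01 df Ka k l e10.
  apply: filterS (bandwidth_near bw tau0) => z.
  rewrite /w /u /hz; case: z => n [|[|N]] [] // _ _ ht1 ht2 /=.
  rewrite distrC; exact: (ht N.+1 (h n N.+2) isT (hz0 (n, N.+2)) ht1 ht2).
have covE z : cov_gram p (w z) (u z) (fun i j => rho (xd i) (xd j)) =
    rho x x *: (s z *m (s z)^T) + hz z *: (((bl + br) / 2) *:
      (s' z *m (s z)^T + s z *m (s' z)^T) - (bl - br) *: Az z + Ez z).
  apply/matrixP => k l; rewrite !mxE !big_ord1 !mxE.
  pose S2 (g : 'I_z.2 -> 'I_z.2 -> R) := \sum_i \sum_j g i j.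
  have S2D g g' : S2 g + S2 g' = S2 (fun i j => g i j + g' i j).
    by rewrite /S2 -big_split/=; apply: eq_bigr => i _; rewrite big_split.
  have S2Z t g : t * S2 g = S2 (fun i j => t * g i j).
    by rewrite /S2 mulr_sumr; apply: eq_bigr => i _; rewrite mulr_sumr.
  have S2N g : - S2 g = S2 (fun i j => - g i j).
    by rewrite /S2 -sumrN; apply: eq_bigr => i _; rewrite -sumrN.
  have momM k1 k2 : mom k1 z * mom k2 z =
      S2 (fun i j => w z i * u z i ^+ k1 * (w z j * u z j ^+ k2)).
    by rewrite /S2 /mom big_distrlr.
  rewrite !momM -/(S2 (fun i j => w z i * w z j * u z i ^+ k * u z j ^+ l * eta z i j)).
  rewrite -/(S2 (fun i j => w z i * w z j * u z i ^+ k * u z j ^+ l * `|u z i - u z j|)).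
  rewrite !(S2Z, S2N, S2D); apply: eq_bigr => i _; apply: eq_bigr => j _.
  have -> : rho (xd i) (xd j) = rho x x + hz z *
      ((bl + br) / 2 * (u z i + u z j) - (bl - br) / 2 * `|u z i - u z j|) + hz z * eta z i j.
    by rewrite /eta [hz z * (_ / _)]mulrC divfK//; ring.
  by rewrite !exprS; field.
(* [s z] is the first column of the Gram matrix at every sample size; likewise [mat_S_star] is the
   first column of [S] times its transpose. *)
pose e0 : 'cV[R]_p.+1 := delta_mx ord0 0.
have sE z : s z = M z *m e0.
  by rewrite /e0 -colE; apply/colP => k; rewrite !mxE addn0.
have GT z : (G z)^T = G z by rewrite /G trmx_inv tr_gram.
pose del := (e^T *m e0) 0 0.
have delT : (e0^T *m e) 0 0 = del.
  by rewrite /del -[e0^T *m e]trmxK trmx_mul trmxK mxE.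
pose y z := (e^T *m (G z *m s' z)) 0 0.
pose q z := (e^T *m (G z *m (Az z *m (G z *m e)))) 0 0.
pose r z := (e^T *m (G z *m (Ez z *m (G z *m e)))) 0 0.
pose qA := (e^T *m Si *m mat_A K p *m Si *m e) 0 0.
have VE z : M z \in unitmx ->
   (e^T *m G z *m cov_gram p (w z) (u z) (fun i j => rho (xd i) (xd j))
         *m G z *m e) 0 0 = rho x x * del ^+ 2 + hz z * ((bl + br) * (y z * del) -
     (bl - br) * q z + r z).
  move=> Mu; rewrite covE.
  (* The existential keeps phi opaque: unfolding it makes unification diverge. *)
  have [phi phiE] : exists phi : 'M[R]_p.+1 -> R,
      forall V, (e^T *m G z *m V *m G z *m e) 0 0 = phi V by eexists.
  have phiD V V' : phi (V + V') = phi V + phi V'.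
    by rewrite -!phiE mulmxDr !mulmxDl add11.
  have phiB V V' : phi (V - V') = phi V - phi V'.
    by rewrite -!phiE mulmxBr !mulmxBl sub11.
  have phiZ t V : phi (t *: V) = t * phi V.
    by rewrite -!phiE -scalemxAr -!scalemxAl scale11.
  have Gs : e^T *m (G z *m s z) = e^T *m e0 by rewrite sE mulKmx.
  have phi1 (a b : 'cV[R]_p.+1) :
      phi (a *m b^T) = (e^T *m (G z *m a)) 0 0 * (e^T *m (G z *m b)) 0 0.
    by rewrite -phiE; exact: (quad_rank1 e a b (GT z)).
  have phiA : phi (Az z) = q z by rewrite -phiE /q !mulmxA.
  have phiEz : phi (Ez z) = r z by rewrite -phiE /r !mulmxA.
  rewrite phiE !(phiB, phiD, phiZ) !phi1 Gs -/del -/(y z) phiA phiEz.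
  by field.
have starE : (e^T *m Si *m mat_S_star K p *m Si *m e) 0 0 = del ^+ 2.
  have -> : mat_S_star K p = (S *m e0) *m (S *m e0)^T.
    have -> : S *m e0 = \col_k kernel_moment K k.
      by rewrite /e0 -colE; apply/colP => k; rewrite !mxE addn0.
    by apply/matrixP => k l; rewrite mxE [RHS]mxE big_ord1 !mxE.
  have SiT : Si^T = Si.
    by rewrite trmx_inv; congr invmx; apply/matrixP => k l; rewrite !mxE addnC.
  by rewrite quad_rank1// mulKmx// expr2.
have cy : y z * del @[z --> sizes_oo] --> (0 : R).
  pose s1 : 'cV[R]_p.+1 := \col_k kernel_moment K k.+1.
  have cs' : mx_cvg sizes_oo s' (f x *: s1).
    move=> k l; rewrite !mxE; under eq_fun do rewrite mxE.
    exact: moment_cvg.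
  (* The product vanishes for [nu > 0] because [del] does. For [nu = 0 < p], [s1] is the second
     column of [S], so [S^-1 s1] is a basis vector with first entry 0; for [p = 0], [s1] is zero by
     symmetry of the kernel. *)
  have <- : (e^T *m (((f x)^-1 *: Si) *m (f x *: s1))) 0 0 * del = 0.
    rewrite -scalemxAl -!scalemxAr scalerA mulVf// scale1r.
    rewrite /del /e0 /e /e_ trmx_delta -!rowE !mxE eqxx andbT.
    have [nu0|_] := eqVneq nu ord0; last by rewrite mulr0.
    rewrite mulr1 nu0; have [p0|p0] := posnP p.
      have -> : s1 = 0; last by rewrite big1// => k _; rewrite mxE mulr0.
      apply/colP => k; rewrite !mxE.
      have -> : nat_of_ord k = 0%N by have := ltn_ord k; move: (nat_of_ord k); lia.
      exact: kernel_moment1.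
    have -> : s1 = S *m delta_mx (inord 1) 0.
      by rewrite -colE; apply/colP => k; rewrite !mxE inordK// addn1.
    have := congr1 (fun B : 'cV[R]_p.+1 => B ord0 0) (mulKmx Su (delta_mx (inord 1) 0)).
    rewrite mxE => ->; rewrite mxE (_ : ord0 == inord 1 = false)//.
    by apply/eqP => /(congr1 val)/=; rewrite inordK.
  apply: cvgM; last exact: cvg_cst.
  exact/mx_cvg11/mx_cvgMl/(mx_cvgM gram_inv_cvg cs').
have cGe : mx_cvg sizes_oo (fun z => G z *m e) (((f x)^-1 *: Si) *m e).
  by apply: mx_cvgM gram_inv_cvg _; exact: mx_cvg_cst.
have cq : q z @[z --> sizes_oo] --> qA.
  have -> : qA = (e^T *m (((f x)^-1 *: Si) *m ((f x ^+ 2 *: mat_A K p) *m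
      (((f x)^-1 *: Si) *m e)))) 0 0.
    rewrite -!scalemxAl -!scalemxAr !scalerA scale11.
    rewrite (_ : _ * _ * _ = 1) ?mul1r; last by field.
    by rewrite /qA !mulmxA.
  exact/mx_cvg11/mx_cvgMl/(mx_cvgM gram_inv_cvg (mx_cvgM cAz cGe)).
have cr : r z @[z --> sizes_oo] --> (0 : R).
  have -> : 0 = (e^T *m (((f x)^-1 *: Si) *m ((0 : 'M[R]_p.+1) *m
      (((f x)^-1 *: Si) *m e)))) 0 0 by rewrite mul0mx !mulmx0 mxE.
  exact/mx_cvg11/mx_cvgMl/(mx_cvgM gram_inv_cvg (mx_cvgM Ez0 cGe)).
pose Q z := (bl + br) * (y z * del) - (bl - br) * (q z - qA) + r z.
have cQ : nu`!%:R ^+ 2 * Q z @[z --> sizes_oo] --> (0 : R).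
  have -> : 0 = nu`!%:R ^+ 2 * ((bl + br) * 0 - (bl - br) * (qA - qA) + 0) :> R by ring.
  apply: cvgM; first exact: cvg_cst.
  apply: cvgD => //; apply: cvgB; (apply: cvgM; first exact: cvg_cst) => //.
  by apply: cvgB => //; exact: cvg_cst.
move/cvgr0Pnorm_le : cQ => /(_ eps eps0) Qe.
have n1 := bandwidth_near bw ltr01.
near=> z.
have Mu : M z \in unitmx by near: z; exact: gram_unit_near.
have [z1 _ _ _] : [/\ (0 < z.1)%N, (1 < z.2)%N, h z.1 z.2 < 1 &
    (z.2.-1%:R * h z.1 z.2 ^+ 2)^-1 < 1] by near: z.
have Qz : `|nu`!%:R ^+ 2 * Q z| <= eps by near: z.
have z1R : z.1%:R != 0 :> R by rewrite pnatr_eq0 -lt0n.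
(* An integer power is needed, as the exponent is -1 when [nu = 0]. *)
have hexp : hz z ^ (2 * nu%:Z - 1) = hz z ^+ (2 * nu) / hz z.
  by rewrite expfzDr// exprN1.
rewrite VE// starE -/qA hexp.
rewrite (_ : _ - _ = nu`!%:R ^+ 2 * Q z * (z.1%:R * (hz z ^+ (2 * nu) / hz z))^-1).
  by rewrite normrM ler_wpM2r.
rewrite /Q exprVn.
have := expf_neq0 (2 * nu) (hzn0 z); have := hzn0 z.
move: (hz z ^+ (2 * nu)) (hz z) => B H H0 B0.
by field; rewrite H0 B0 z1R.
Unshelve. all: by end_near. Qed.

End asymptotics.

Theorem theorem1 (R : realType) (d : measure_display) (T : measurableType d)
    (P : probability T R) (p : nat) (nu : 'I_p.+1) (x : R)
    (m f K : R -> R) (rho : R -> R -> R)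
    (eps : nat -> R -> {RV P >-> R})
    (xd : forall N : nat, 'I_N -> R) (h : nat -> nat -> R) :
  0 < x < 1 ->
  iid_centered_errors eps rho ->
  positive_density01 f ->
  design_points f xd ->
  kernel_assumption K ->
  bandwidth_assumption nu h ->
  Ck_on `[0, 1] p.+2 m ->
  Ck_on `[0, 1] 1 f ->
  covariance_assumption rho ->
  let mhat (n N : nat) (w : T) : R :=
    lp_estimator K (h n N) x (xd N)
      (mean_obs m (fun i t => eps i t : T -> R) n (xd N) w) nu in
  let Sinv := invmx (mat_S K p) in
  let e := e_ R nu in
  let c := vec_c K p in
  let ct := vec_c_tilde K p in
  (fun z : nat * nat => bias P (mhat z.1 z.2) (derive1n nu m x)) =
    (fun z : nat * nat =>
       nu`!%:R * derive1n p.+1 m x / p.+1`!%:R *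
         (e^T *m Sinv *m c) 0 0 * h z.1 z.2 ^+ (p.+1 - nu) +
       nu`!%:R *
         (derive1n p.+2 m x / p.+2`!%:R * (e^T *m Sinv *m ct) 0 0 +
          derive1n p.+1 m x / p.+1`!%:R * (derive1 f x / f x) *
            ((e^T *m Sinv *m ct) 0 0 -
             (e^T *m Sinv *m mat_S_tilde K p *m Sinv *m c) 0 0)) *
         h z.1 z.2 ^+ (p.+2 - nu))
    +o_sizes_oo (fun z : nat * nat => h z.1 z.2 ^+ (p.+2 - nu))
  /\
  (fun z : nat * nat => var P (mhat z.1 z.2)) =
    (fun z : nat * nat =>
       nu`!%:R ^+ 2 * rho x x / (z.1%:R * h z.1 z.2 ^+ (2 * nu)) *
         (e^T *m Sinv *m mat_S_star K p *m Sinv *m e) 0 0 -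
       nu`!%:R ^+ 2 / (z.1%:R * h z.1 z.2 ^ (2 * nu%:Z - 1)) *
         (rho01_left rho x - rho01_right rho x) *
         (e^T *m Sinv *m mat_A K p *m Sinv *m e) 0 0)
    +o_sizes_oo (fun z : nat * nat => (z.1%:R * h z.1 z.2 ^ (2 * nu%:Z - 1))^-1).
Proof.
move=> x01 iid fd dp Ka bw [D [D0 Dc dD]] [Df [Df0 Dfc dDf]] cov mhat Sinv e c ct.
have x01i := itvoo_interior_cc x01.
have near01 : \forall y \near x, 0 < y < 1.
  have : x \in `]0, 1[ by rewrite in_itv.
  by move=> /near_in_itvoo; apply: filterS => y; rewrite in_itv.
have dDn (g : nat -> R -> R) k :
    (forall j y, (j < k)%N -> `[0, 1]%classic y -> is_derive_within `[0, 1] (g j) y (g j.+1 y)) ->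
    \forall y \near x, forall j, (j < k)%N -> is_derive y (1 : R) (g j) (g j.+1 y).
  move=> dg; apply: filterS near01 => y y01 j jk.
  apply: is_derive_within_interior (itvoo_interior_cc y01) (dg _ _ jk _).
  exact: interior_subset (itvoo_interior_cc y01).
have dE k : (k <= p.+2)%N -> derive1n k m x = D k x.
  by rewrite -D0 => kp; exact: derive1n_within01 dD kp x01.
have f1E : derive1 f x = Df 1%N x.
  by rewrite -Df0 -derive1n1; exact: derive1n_within01 dDf _ x01.
have taylor := taylor_peano (dDn D p.+2 dD) (within_continuous_interior (Dc _ (leqnn _)) x01i).
have df : forall e0, 0 < e0 -> \forall y \near x,
    `|f y - f x - Df 1%N x * (y - x)| <= e0 * `|y - x|.
  move=> e0 e00.
  have := taylor_peano (dDn Df 1%N dDf) (within_continuous_interior (Dfc _ (leqnn _)) x01i) e00.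
  apply: filterS => y; rewrite 2!big_ord_recr big_ord0/= Df0 add0r !fact0 !divr1 !expr1 mulr1.
  by rewrite opprD addrA.
(* [rho] inherits its symmetry from the products of errors whose expectation it is. *)
have sym y z : y \in `[0, 1] -> z \in `[0, 1] -> rho y z = rho z y.
  move=> y1 z1; have [_ _ _ second] := iid; apply: EFin_inj.
  rewrite -(second 0%N y z y1 z1) -(second 0%N z y z1 y1).
  by congr ('E_P[_])%E; apply/funext => v; rewrite mulrC.
have rhoE := covariance_expansion x01 cov sym.
rewrite D0 in taylor.
have [h0 _ _ _] := bw; have [_ _ K0 _ _] := Ka.
have gu := gram_unit_near fd dp x01 df Ka bw.
(* Eventually the Gram matrix is invertible and the exact formulas of [lp_estimator_moments] apply,
   with [kappa = 1 / ((N - 1) h)]. *)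
have moments : \forall z \near sizes_oo,
    fine 'E_P[mhat z.1 z.2] = nu`!%:R * (h z.1 z.2)^-1 ^+ nu *
      ((e_ R nu)^T *m
         invmx (gram p (design_w K xd x (h z.1 z.2) (N := z.2))
                       (design_u xd x (h z.1 z.2) (N := z.2))) *m
         weighted_moments p (design_w K xd x (h z.1 z.2) (N := z.2))
            (design_u xd x (h z.1 z.2) (N := z.2)) (m \o @xd z.2)) 0 0 /\
    var P (mhat z.1 z.2) = nu`!%:R ^+ 2 * (h z.1 z.2)^-1 ^+ (2 * nu) * z.1%:R^-1 *
      ((e_ R nu)^T *m
         invmx (gram p (design_w K xd x (h z.1 z.2) (N := z.2))
                       (design_u xd x (h z.1 z.2) (N := z.2))) *m
         cov_gram p (design_w K xd x (h z.1 z.2) (N := z.2))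
            (design_u xd x (h z.1 z.2) (N := z.2)) (fun i j => rho (xd z.2 i) (xd z.2 j)) *m
         invmx (gram p (design_w K xd x (h z.1 z.2) (N := z.2))
                       (design_u xd x (h z.1 z.2) (N := z.2))) *m
         e_ R nu) 0 0.
  apply: filterS2 gu (bandwidth_near bw ltr01) => z Mu [z1 z2 _ _].
  have kappa0 : 0 < (z.2.-1%:R * h z.1 z.2)^-1.
    by rewrite invr_gt0 mulr_gt0// ltr0n -subn1 subn_gt0.
  have [E V] := lp_estimator_moments nu m iid z1 (h0 z.1 z.2) kappa0 K0
     (fun j => (dp z.2 j z2).1) (fun j => erefl) Mu.
  by rewrite /var E V.
rewrite /e /Sinv /c /ct (dE _ (leqnn _)) (dE _ (leqnSn _)) f1E.
rewrite (dE nu (leq_trans (ltnW (ltn_ord nu)) (leqnSn _))).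
split; apply/eqaddoP => eps0 e0.
  have rem := bias_remainder (d := D^~ x) fd dp x01 df Ka bw taylor e0.
  apply: filterS2 moments rem => z [E _] /=; cbv beta.
  by rewrite -E.
have rem := variance_remainder fd dp x01 df Ka bw rhoE e0.
apply: filterS2 moments rem => z [_ V] /=; cbv beta.
by rewrite -V.
Qed.
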